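(* Let $F$ be a free group of finite rank and let $\phi\in\mathrm{Aut}(F)$ be polynomially growing. If $\phi$ is unipotent, then for every $n\geq1$ the group $$\left(F\rtimes_\phi\mathbb{Z}\right)/\gamma_nF$$ is torsion-free nilpotent.
   Context: $\gamma_1F=F$ and $\gamma_{n+1}F=[\gamma_nF,F]$ are the terms of the lower central series of $F$; each $\gamma_nF$ is characteristic in $F$, hence normal in $F\rtimes_\phi\mathbb{Z}$. An automorphism $\phi$ of $F$ is called unipotent (resp. polynomially growing) if its outer class $\Phi$ is. $\Phi$ is unipotent if it induces a unipotent element of $\mathrm{GL}(H_1(F;\mathbb{Z}))$. Growth: fix a free basis $X$ of $F$; for a conjugacy class $\bar g$ let $|\bar g|_X$ be the word length of a shortest representative. The class $\bar g$ grows polynomially of degree $d$ under $\Phi$ if there are constants $A,B>0$ with $Ak^d-A\leq|\Phi^k(\bar g)|_X\leq Bk^d$ for all $k\geq1$. $\Phi$ grows polynomially of degree $d$ if every conjugacy class grows polynomially of degree $\leq d$ and some class grows polynomially of degree exactly $d$; $\Phi$ is polynomially growing if this holds for some integer $d\geq0$. *)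

(* Defs.v *)
Set Warnings "-notation-overridden,-ambiguous-paths".
From HB Require Import structures.
From mathcomp Require Import all_boot all_order all_algebra.
From mathcomp Require Import boolp classical_sets reals.

Set Implicit Arguments.
Unset Strict Implicit.
Unset Printing Implicit Defensive.

Import Order.TTheory GRing.Theory Num.Theory.

Local Open Scope quotient_scope.
Local Open Scope classical_set_scope.
Local Open Scope group_scope.

Section LowerCentralSeries.
Variable G : groupType.

Definition is_subgroup (H : set G) : Prop :=
  H 1 /\ (forall x y, H x -> H y -> H (x / y)).

Definition gen (A : set G) : set G := smallest is_subgroup A.

Fixpoint lcs (k : nat) : set G :=
  if k is k'.+1 then gen [set [~ x, y] | x in lcs k' & y in setT] else setT.

(* 1-based, as usual: gamma 1 is the whole group (the value at 0 is junk). *)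
Definition gamma (n : nat) : set G := lcs n.-1.

Lemma is_subgroup_gen A : is_subgroup (gen A).
Proof.
split=> [H [[]//]|x y hx hy H hH].
by case: (hH) => -[_ hd] _; apply: hd; [apply: hx|apply: hy].
Qed.

Lemma is_subgroup_gamma n : is_subgroup (gamma n).
Proof. by rewrite /gamma; case: n.-1 => [//|k]; exact: is_subgroup_gen. Qed.

Lemma is_subgroupV H x : is_subgroup H -> H x -> H x^-1.
Proof. by move=> [h1 hd] hx; rewrite -div1g; exact: hd. Qed.

Lemma is_subgroupM H x y : is_subgroup H -> H x -> H y -> H (x * y).
Proof.
by move=> hH hx hy; rewrite -[y]invgK; apply: hH.2 => //; exact: is_subgroupV.
Qed.

Definition torsion_free : Prop :=
  forall (x : G) (k : nat), (0 < k)%N -> x ^+ k = 1 -> x = 1.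

Definition nilpotent : Prop := exists n : nat, gamma n = [set 1].

End LowerCentralSeries.

Lemma lcs_morph (G H : groupType) (f : G -> H) k x :
  {morph f : x y / x * y} -> lcs k x -> lcs k (f x).
Proof.
move=> fM; have f1 : f 1 = 1.
  by apply: (@mulgI _ (f 1)); rewrite -fM !mulg1.
have fV y : f y^-1 = (f y)^-1.
  by apply/esym/mulg1_eq; rewrite -fM mulgV.
elim: k x => [//|k IHk] x hx; apply: (hx (fun x => lcs k.+1 (f x))) => {x hx}.
split; first split.
- by rewrite f1; exact: (is_subgroup_gen _).1.
- by move=> x y hx hy; rewrite fM fV; exact: (is_subgroup_gen _).2.
move=> _ [x hx [y _ <-]]; apply: sub_gen_smallest.
by exists (f x); [exact: IHk|exists (f y) => //; rewrite !fM !fV].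
Qed.

Record normalSubgroup (G : groupType) := NormalSubgroup {
  nsub : set G;
  nsub_subgroup : is_subgroup nsub;
  nsub_conj : forall x y, nsub x -> nsub (x ^ y)
}.

Lemma gamma_conj (G : groupType) n (x y : G) : gamma n x -> gamma n (x ^ y).
Proof. by apply: (@lcs_morph G G (conjg ^~ y)) => a b; rewrite conjMg. Qed.

Definition gammaN (G : groupType) (n : nat) : normalSubgroup G :=
  NormalSubgroup (@is_subgroup_gamma G n) (@gamma_conj G n).

Section Quotient.
Variables (G : groupType) (N : normalSubgroup G).

Definition coset_rel : rel G := fun x y => `[< nsub N (x^-1 * y) >].

Lemma coset_rel_equiv : equiv_class_of coset_rel.
Proof.
split=> [x|x y|y x z].
- by apply/asboolP; rewrite mulVg; exact: (nsub_subgroup N).1.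
- apply/asboolP/asboolP => /(is_subgroupV (nsub_subgroup N));
  by rewrite invgM invgK.
- move=> /asboolP hxy /asboolP hyz; apply/asboolP.
  by have := is_subgroupM (nsub_subgroup N) hxy hyz; rewrite mulgA mulgK.
Qed.

Canonical coset_equiv := EquivRelPack coset_rel_equiv.

Definition quot : Type := {eq_quot coset_equiv}.

HB.instance Definition _ := Choice.on quot.
HB.instance Definition _ := EqQuotient.on quot.

Lemma quot_elim (P : quot -> Prop) : (forall x, P (\pi_quot x)) -> forall c, P c.
Proof. exact: quotW. Qed.

Lemma quot_eqP (x y : G) : \pi_quot x = \pi_quot y <-> nsub N (x^-1 * y).
Proof. by split=> [/eqmodP/asboolP|?]; last exact/eqmodP/asboolP. Qed.

Definition quot_one : quot := \pi_quot 1.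
Definition quot_mul (a b : quot) : quot := \pi_quot (repr a * repr b).
Definition quot_inv (a : quot) : quot := \pi_quot (repr a)^-1.

Lemma quot_reprP (x : G) : nsub N (x^-1 * repr (\pi_quot x)).
Proof. by apply/quot_eqP; rewrite reprK. Qed.

Lemma quot_mulE (x y : G) : quot_mul (\pi_quot x) (\pi_quot y) = \pi_quot (x * y).
Proof.
apply/esym/quot_eqP; set x' := repr _; set y' := repr _.
have -> : (x * y)^-1 * (x' * y') = (x^-1 * x') ^ y * (y^-1 * y').
  by rewrite conjgE invgM !mulgA mulgK.
by apply: is_subgroupM (nsub_subgroup N) _ (quot_reprP y);
  exact/nsub_conj/quot_reprP.
Qed.

Lemma quot_invE (x : G) : quot_inv (\pi_quot x) = \pi_quot x^-1.
Proof.
apply/quot_eqP; rewrite invgK; set x' := repr _.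
have -> : x' * x^-1 = (x^-1 * x') ^ x^-1 by rewrite conjgE invgK !mulgA mulgV mul1g.
exact/nsub_conj/quot_reprP.
Qed.

Lemma quot_mulA : associative quot_mul.
Proof.
elim/quot_elim=> x; elim/quot_elim=> y; elim/quot_elim=> z.
by rewrite !quot_mulE mulgA.
Qed.
Lemma quot_mul1 : left_id quot_one quot_mul.
Proof. by elim/quot_elim=> x; rewrite quot_mulE mul1g. Qed.
Lemma quot_mulr1 : right_id quot_one quot_mul.
Proof. by elim/quot_elim=> x; rewrite quot_mulE mulg1. Qed.
Lemma quot_mulV : left_inverse quot_one quot_inv quot_mul.
Proof. by elim/quot_elim=> x; rewrite quot_invE quot_mulE mulVg. Qed.
Lemma quot_mulrV : right_inverse quot_one quot_inv quot_mul.
Proof. by elim/quot_elim=> x; rewrite quot_invE quot_mulE mulgV. Qed.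

HB.instance Definition _ := isGroup.Build quot
  quot_mulA quot_mul1 quot_mulr1 quot_mulV quot_mulrV.

Lemma quot_piM (x y : G) : \pi_quot (x * y) = \pi_quot x * \pi_quot y.
Proof. by rewrite -quot_mulE. Qed.

End Quotient.

Record aut (G : groupType) := Aut {
  aut_fun :> G -> G;
  autM : {morph aut_fun : x y / x * y};
  aut_bij : bijective aut_fun
}.

HB.instance Definition _ G := gen_eqMixin (aut G).
HB.instance Definition _ G := gen_choiceMixin (aut G).

Section AutGroup.
Variable G : groupType.
Implicit Types f g h : aut G.

Lemma autP f g : f =1 g -> f = g.
Proof.
case: f g => [f fM fb] [g gM gb] /= /funext fg; case: _ / fg in gM gb *.
by congr Aut; exact: Prop_irrelevance.
Qed.

Definition aut_one : aut G :=
  @Aut G id (fun _ _ => erefl) (Bijective (fun _ => erefl) (fun _ => erefl)).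

Lemma aut_mulM f g : {morph f \o g : x y / x * y}.
Proof. by move=> x y /=; rewrite !autM. Qed.
Definition aut_mul f g : aut G :=
  Aut (@aut_mulM f g) (bij_comp (aut_bij f) (aut_bij g)).

Lemma aut_inv_ex f : exists g : G -> G, cancel f g /\ cancel g f.
Proof. by case: (aut_bij f) => g; exists g. Qed.
Definition aut_invfun f : G -> G := sval (cid (aut_inv_ex f)).
Lemma aut_funK f : cancel f (aut_invfun f).
Proof. exact: (svalP (cid (aut_inv_ex f))).1. Qed.
Lemma aut_invfunK f : cancel (aut_invfun f) f.
Proof. exact: (svalP (cid (aut_inv_ex f))).2. Qed.
Lemma aut_invfunM f : {morph aut_invfun f : x y / x * y}.
Proof.
by move=> x y; apply: (can_inj (aut_funK f)); rewrite autM !aut_invfunK.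
Qed.
Definition aut_inv f : aut G :=
  Aut (@aut_invfunM f) (Bijective (aut_invfunK f) (aut_funK f)).

Lemma aut_mulA : associative aut_mul. Proof. by move=> f g h; exact: autP. Qed.
Lemma aut_mul1 : left_id aut_one aut_mul. Proof. by move=> f; exact: autP. Qed.
Lemma aut_mulr1 : right_id aut_one aut_mul. Proof. by move=> f; exact: autP. Qed.
Lemma aut_mulV : left_inverse aut_one aut_inv aut_mul.
Proof. by move=> f; apply: autP => x; exact: aut_funK. Qed.
Lemma aut_mulrV : right_inverse aut_one aut_inv aut_mul.
Proof. by move=> f; apply: autP => x; exact: aut_invfunK. Qed.

HB.instance Definition _ := isGroup.Build (aut G)
  aut_mulA aut_mul1 aut_mulr1 aut_mulV aut_mulrV.

Lemma autME f g x : (f * g) x = f (g x). Proof. by []. Qed.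
Lemma aut1E x : (1 : aut G) x = x. Proof. by []. Qed.
Lemma autKV f x : f (f^-1 x) = x. Proof. exact: aut_invfunK. Qed.
Lemma autVK f x : f^-1 (f x) = x. Proof. exact: aut_funK. Qed.
Lemma autg1 f : f 1 = 1.
Proof. by apply: (@mulgI _ (f 1)); rewrite -autM !mulg1. Qed.
Lemma autV f x : f x^-1 = (f x)^-1.
Proof. by apply/esym/mulg1_eq; rewrite -autM mulgV autg1. Qed.
Lemma autJ f x y : f (x ^ y) = f x ^ f y.
Proof. by rewrite !conjgE !autM autV. Qed.

Lemma inner_bij (y : G) : bijective (conjg ^~ y).
Proof. by exists (conjg ^~ y^-1); [exact: conjgK|exact: conjgKV]. Qed.
Definition inner (y : G) : aut G :=
  Aut (fun a b => conjMg a b y) (inner_bij y).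

Lemma inner_subgroup : is_subgroup (range inner).
Proof.
split; first by exists 1 => //; apply: autP => x /=; rewrite conjg1.
move=> _ _ [y _ <-] [z _ <-]; exists (z^-1 * y) => //; apply: autP => x.
have zE : (inner z)^-1 x = x ^ z^-1.
  by apply: (can_inj (aut_funK (inner z))); rewrite autKV /= conjgKV.
by rewrite autME zE /= conjgM.
Qed.

Lemma inner_conj f g : range inner f -> range inner (f ^ g).
Proof.
move=> [y _ <-]; exists (g^-1 y) => //; apply: autP => x.
by rewrite [RHS](_ : _ = g^-1 (g x ^ y)) // autJ autVK.
Qed.

Definition Inn : normalSubgroup (aut G) :=
  NormalSubgroup inner_subgroup inner_conj.

Definition Out : groupType := quot Inn.

Definition outer (f : aut G) : Out := \pi_(quot Inn) f.

(* A representative of an outer class; the constructions below that use it do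
   not depend on the choice, see [out_H1E] and [out_classE]. *)
Definition out_repr (Phi : Out) : aut G := repr (Phi : quot Inn).

Lemma out_reprP f : exists y, forall x, out_repr (outer f) x = f (x ^ y).
Proof.
have [y _ /(congr1 (fun h => f * h))] := quot_reprP Inn f.
by rewrite mulVKg => e; exists y => x; rewrite /out_repr /outer -e.
Qed.

End AutGroup.

(* The integral first homology H_1(G; Z) is the abelianization of G, written additively. *)
Definition H1 (G : groupType) : Type := quot (gammaN G 2).

Section H1.
Variable G : groupType.

HB.instance Definition _ := Choice.on (H1 G).

Definition toH1 (x : G) : H1 G := \pi_(quot (gammaN G 2)) x.

Lemma toH1W (P : H1 G -> Prop) : (forall x, P (toH1 x)) -> forall c, P c.
Proof. exact: quotW. Qed.

Lemma H1_eqP (x y : G) : toH1 x = toH1 y <-> gamma 2 (x^-1 * y).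
Proof. exact: quot_eqP. Qed.

Definition H1_zero : H1 G := 1.
Definition H1_add (a b : H1 G) : H1 G := (a : quot (gammaN G 2)) * b.
Definition H1_opp (a : H1 G) : H1 G := (a : quot (gammaN G 2))^-1.

Lemma H1_addA : associative H1_add. Proof. exact: mulgA. Qed.
Lemma H1_addC : commutative H1_add.
Proof.
elim/toH1W=> x; elim/toH1W=> y; rewrite /H1_add -!quot_piM; apply/H1_eqP.
rewrite invgM -mulgA; apply: sub_gen_smallest.
by exists y => //; exists x => //; rewrite commgEl conjgE.
Qed.
Lemma H1_add0 : left_id H1_zero H1_add. Proof. exact: mul1g. Qed.
Lemma H1_addN : left_inverse H1_zero H1_opp H1_add. Proof. exact: mulVg. Qed.

HB.instance Definition _ :=
  GRing.isZmodule.Build (H1 G) H1_addA H1_addC H1_add0 H1_addN.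

Lemma toH1M x y : toH1 (x * y) = (toH1 x + toH1 y)%R.
Proof. exact: quot_piM. Qed.

Lemma toH1_1 : toH1 1 = 0%R.
Proof. by []. Qed.

Definition H1_map (f : aut G) (c : H1 G) : H1 G :=
  toH1 (f (repr (c : quot (gammaN G 2)))).

Lemma H1_mapE (f : aut G) x : H1_map f (toH1 x) = toH1 (f x).
Proof.
apply/esym/H1_eqP; rewrite -autV -autM; apply: lcs_morph (@autM _ f) _.
exact: (quot_reprP (gammaN G 2)).
Qed.

Lemma H1_mapD (f : aut G) : {morph H1_map f : a b / (a + b)%R}.
Proof.
elim/toH1W=> x; elim/toH1W=> y.
by rewrite -toH1M !H1_mapE autM toH1M.
Qed.

Definition out_H1 (Phi : Out G) : H1 G -> H1 G := H1_map (out_repr Phi).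

Lemma out_H1E (f : aut G) : out_H1 (outer f) = H1_map f.
Proof.
apply/funext; elim/toH1W => x; have [y fE] := out_reprP f.
rewrite /out_H1 !H1_mapE fE conjgE !autM !toH1M addrCA.
by rewrite -[X in (_ + X)%R]toH1M -autM mulVg autg1 toH1_1 addr0.
Qed.

End H1.

Definition unipotent_map (V : zmodType) (u : V -> V) : Prop :=
  exists m : nat, forall v : V, iter m (fun w => u w - w)%R v = 0%R.

Definition out_unipotent (G : groupType) (Phi : Out G) : Prop :=
  unipotent_map (out_H1 Phi).

Definition unipotent (G : groupType) (f : aut G) : Prop :=
  out_unipotent (outer f).

Definition free_basis (F : groupType) (r : nat) (X : 'I_r -> F) : Prop :=
  forall (H : groupType) (a : 'I_r -> H),
    exists! f : F -> H, {morph f : x y / x * y} /\ (forall i, f (X i) = a i).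

(* The minimum of a nonempty set of natural numbers (0 for the empty set). *)
Definition set_minn (A : set nat) : nat :=
  if pselect (exists n, `[< A n >]) is left exA then ex_minn exA else 0%N.

Lemma set_minnP (A : set nat) : A !=set0 ->
  A (set_minn A) /\ (forall n, A n -> (set_minn A <= n)%N).
Proof.
move=> [n An]; rewrite /set_minn; case: pselect => [exA|[]]; last first.
  by exists n; exact/asboolP.
by case: ex_minnP => m /asboolP Am mmin; split=> // k /asboolP; exact: mmin.
Qed.

Section Growth.
Variables (F : groupType) (r : nat) (X : 'I_r -> F).

(* Words in the letters X_i (tag true) and X_i^-1 (tag false). *)
Definition word_eval (w : seq ('I_r * bool)) : F :=
  \prod_(l <- w) (if l.2 then X l.1 else (X l.1)^-1).

Definition word_length (g : F) : nat :=
  set_minn [set size w | w in [set w | word_eval w = g]].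

Definition conj_class (g : F) : set F := [set g ^ x | x in setT].

Definition class_length (C : set F) : nat := set_minn [set word_length g | g in C].

Definition out_class (Phi : Out F) (C : set F) : set F := out_repr Phi @` C.

Lemma out_classE (f : aut F) (g : F) :
  out_class (outer f) (conj_class g) = conj_class (f g).
Proof.
have [y fE] := out_reprP f; apply/seteqP; split=> [_ [_ [x _ <-] <-]|_ [x _ <-]].
  by exists (f (x * y)) => //; rewrite fE -conjgM autJ.
exists (g ^ (f^-1 x * y^-1)); first by exists (f^-1 x * y^-1).
by rewrite fE -conjgM mulgVK autJ autKV.
Qed.

Variable R : realType.

Definition class_grows (Phi : Out F) (C : set F) (d : nat) : Prop :=
  exists A B : R, [/\ (0 < A)%R, (0 < B)%R &
    forall k : nat, (1 <= k)%N ->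
      (A * k%:R ^+ d - A <= (class_length (out_class (Phi ^+ k) C))%:R
         <= B * k%:R ^+ d)%R].

Definition out_grows (Phi : Out F) (d : nat) : Prop :=
  (forall g : F, exists2 d' : nat, (d' <= d)%N &
     class_grows Phi (conj_class g) d') /\
  (exists g : F, class_grows Phi (conj_class g) d).

Definition out_polynomially_growing (Phi : Out F) : Prop :=
  exists d : nat, out_grows Phi d.

Definition polynomially_growing (f : aut F) : Prop :=
  out_polynomially_growing (outer f).

End Growth.

Definition expgz (G : groupType) (x : G) (m : int) : G :=
  match m with Posz n => x ^+ n | Negz n => x ^- n.+1 end.

Lemma expgzS (G : groupType) (x : G) (m : int) :
  expgz x (m + 1)%R = expgz x m * x.
Proof.
case: m => [n|[|n]]; first by rewrite addrC -intS /= expgSr.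
  by rewrite /= mulVg.
rewrite [(_ + 1)%R](_ : _ = Negz n) /= ?[x ^+ n.+2]expgS ?invgM ?mulgVK //.
by rewrite !NegzE [in LHS]intS opprD addrC addrA subrr add0r.
Qed.

Lemma expgzD (G : groupType) (x : G) (m n : int) :
  expgz x (m + n)%R = expgz x m * expgz x n.
Proof.
elim/int_rect: n => [|n IHn|n IHn]; first by rewrite addr0 mulg1.
  by rewrite intS [(1 + _)%R]addrC addrA !expgzS IHn mulgA.
apply: (@mulIg _ x); rewrite -expgzS -mulgA -expgzS.
by rewrite intS opprD [(-1 + _)%R]addrC addrA !addrNK.
Qed.

Section SemidirectProduct.
Variables (G : groupType) (f : aut G).

(* The pair (a, m) stands for a t^m, where t a t^-1 = f a. *)
Definition sdprodZ : Type := (G * int)%type.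

HB.instance Definition _ := Choice.on sdprodZ.

Implicit Types u v w : sdprodZ.

Definition sdprodZ_one : sdprodZ := (1, 0%R).
Definition sdprodZ_mul u v : sdprodZ := (u.1 * expgz f u.2 v.1, (u.2 + v.2)%R).
Definition sdprodZ_inv u : sdprodZ := (expgz f (- u.2)%R u.1^-1, (- u.2)%R).

Lemma expgz_autK (m : int) x : expgz f (- m)%R (expgz f m x) = x.
Proof. by rewrite -autME -expgzD addNr. Qed.
Lemma expgz_autVK (m : int) x : expgz f m (expgz f (- m)%R x) = x.
Proof. by rewrite -autME -expgzD addrN. Qed.

Lemma sdprodZ_mulA : associative sdprodZ_mul.
Proof.
move=> [a m] [b n] [c p]; rewrite /sdprodZ_mul /=.
by rewrite autM expgzD autME mulgA addrA.
Qed.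
Lemma sdprodZ_mul1 : left_id sdprodZ_one sdprodZ_mul.
Proof. by move=> [a m]; rewrite /sdprodZ_mul /= mul1g add0r. Qed.
Lemma sdprodZ_mulr1 : right_id sdprodZ_one sdprodZ_mul.
Proof. by move=> [a m]; rewrite /sdprodZ_mul /= autg1 mulg1 addr0. Qed.
Lemma sdprodZ_mulV : left_inverse sdprodZ_one sdprodZ_inv sdprodZ_mul.
Proof. by move=> [a m]; rewrite /sdprodZ_mul /= -autM mulVg autg1 addNr. Qed.
Lemma sdprodZ_mulrV : right_inverse sdprodZ_one sdprodZ_inv sdprodZ_mul.
Proof. by move=> [a m]; rewrite /sdprodZ_mul /= expgz_autVK mulgV addrN. Qed.

HB.instance Definition _ := isGroup.Build sdprodZ
  sdprodZ_mulA sdprodZ_mul1 sdprodZ_mulr1 sdprodZ_mulV sdprodZ_mulrV.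

Definition sdprodZ_inl (x : G) : sdprodZ := (x, 0%R).

Lemma sdprodZ_gamma_subgroup n : is_subgroup (sdprodZ_inl @` gamma n).
Proof.
have [h1 hd] := is_subgroup_gamma G n.
split; first by exists 1.
move=> _ _ [x hx <-] [y hy <-]; exists (x / y); first exact: hd.
by rewrite /sdprodZ_inl; congr (_, _).
Qed.

Lemma sdprodZ_gamma_conj n u v :
  (sdprodZ_inl @` gamma n) u -> (sdprodZ_inl @` gamma n) (u ^ v).
Proof.
case: v => a m [x hx <-]; exists (expgz f (- m)%R (x ^ a)).
  by apply: lcs_morph (@autM _ _) _; exact: gamma_conj.
rewrite [in RHS]/conjg; congr (_, _); last by rewrite /= add0r addNr.
by rewrite /= -autM conjgE.
Qed.

Definition sdprodZ_gammaN (n : nat) : normalSubgroup sdprodZ :=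
  NormalSubgroup (@sdprodZ_gamma_subgroup n) (@sdprodZ_gamma_conj n).

End SemidirectProduct.

(* Main.v *)
Require Import Defs.
From HB Require Import structures.
From mathcomp Require Import all_boot all_order all_algebra.
From mathcomp Require Import boolp classical_sets functions reals.

(** Torsion-freeness. Since [Z] is torsion-free, a torsion element of the
   quotient lies in [F / gamma n], so it is enough that [x ^+ k] in [gamma
   n] with [k > 0] forces [x] in [gamma n], that is, that the quotients
   [gamma i / gamma i.+1] of the free group [F] are torsion-free. This is
   the theorem of Magnus and Witt, proved here with Lyndon words. Every
   standard bracketing of a Lyndon word of length [i] gives a basic
   commutator in [gamma i].
   - They span [gamma i] modulo [gamma i.+1] ([gamma_basic]): the Jacobi
     identity rewrites a commutator of two basic commutators into basic ones
     ([basic_span_comm]).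
   - They are independent. The Magnus expansion sends the generator [x_a] to
     the unit [1 + a] of the ring of power series in noncommuting variables,
     and [gamma i] to [1] plus terms of degree at least [i]
     ([magnus_gamma]). The terms of degree [i] depend additively on the
     element of [gamma i], and for a basic commutator they are its Lyndon
     word plus larger words ([magnus_commtree]).
   So an element of [gamma i] whose expansion vanishes in degree [i] is in
   [gamma i.+1] ([gamma_magnus_eq0]). The terms of degree [i] for [x ^+ k]
   being [k] times those for [x], the torsion-freeness of the integers
   concludes ([gamma_root]).

   Nilpotency. This is the argument of P. Hall for extensions whose kernel
   is nilpotent. The automorphisms by which [F ><| Z] acts on [F] are
   unipotent on the abelianization, being powers of [phi] up to inner
   automorphisms ([unipotent_chain_H1]). As [gamma i.+1 / gamma i.+2] is a
   quotient of the tensor product of [gamma i / gamma i.+1] with the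
   abelianization, they are unipotent on every [gamma i / gamma i.+1]
   ([unipotent_chain_comm]). Concatenating the resulting chains from [F]
   down to [gamma n], each commutator with an element of [F ><| Z] descends
   one step ([lcs_unipotent_chain]), and the first commutator already lands
   in [F], as [Z] is abelian ([lcs1_quot]). *)

Set Implicit Arguments.
Unset Strict Implicit.
Unset Printing Implicit Defensive.

Import Order.TTheory GRing.Theory Num.Theory.

Local Open Scope quotient_scope.
Local Open Scope classical_set_scope.
Local Open Scope group_scope.

(** * Commutator calculus along the lower central series *)

(* Rewrites both sides of an equation to right-associated reduced words. *)
Ltac group_norm :=
  rewrite /commg /conjg ?(invgM, invgK) -?mulgA
    ?(mulKg, mulVKg, mulgV, mulVg, mulg1, mul1g) //.

Section CommutatorCalculus.
Variable G : groupType.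
Implicit Types (x y z : G) (S : set G).

Lemma commMgJ x y z : [~ x * y, z] = [~ x, z] ^ y * [~ y, z].
Proof. by group_norm. Qed.

Lemma commVgJ x y : [~ x^-1, y] = ([~ x, y]^-1) ^ x^-1.
Proof. by group_norm. Qed.

Lemma commgVJ x y : [~ x, y^-1] = ([~ x, y]^-1) ^ y^-1.
Proof. by group_norm. Qed.

Lemma commVVJ x y : [~ x^-1, y^-1] = [~ x, y] ^ (y * x)^-1.
Proof. by group_norm. Qed.

Lemma hall_witt x y z :
  [~ [~ x, y^-1], z] ^ y * [~ [~ y, z^-1], x] ^ z * [~ [~ z, x^-1], y] ^ x = 1.
Proof. by group_norm. Qed.

Lemma gen_subset S (A : set G) : is_subgroup S -> A `<=` S -> gen A `<=` S.
Proof. by move=> hS hA x; apply. Qed.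

Lemma gen_incl (A : set G) : A `<=` gen A.
Proof. exact: sub_gen_smallest. Qed.

Lemma gammaM n x y : gamma n x -> gamma n y -> gamma n (x * y).
Proof. by apply: is_subgroupM; exact: is_subgroup_gamma. Qed.

Lemma gammaV n x : gamma n x -> gamma n x^-1.
Proof. by apply: is_subgroupV; exact: is_subgroup_gamma. Qed.

Lemma gamma_commS n x y : gamma n x -> gamma n.+1 [~ x, y].
Proof. by case: n => [//|n] hx; apply: gen_incl; exists x => //; exists y. Qed.

Lemma gamma_decr n : gamma n.+1 `<=` @gamma G n.
Proof.
case: n => [//|n]; apply: gen_subset => [|_ [x hx [y _ <-]]].
  exact: is_subgroup_gamma.
by rewrite commgEl; apply: gammaM; [exact: gammaV|exact: gamma_conj].
Qed.

(** The three subgroups lemma: the Hall-Witt identity moves one letter of a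
   commutator in [gamma q.+1] over to the other side. *)
Lemma gamma_comm p q x y : gamma p x -> gamma q y -> gamma (p + q) [~ x, y].
Proof.
elim: q p x y => [|[|q] IHq] p x y hx hy.
- by rewrite addn0; exact/gamma_decr/gamma_commS.
- by rewrite addn1; exact: gamma_commS.
rewrite -invgR; apply: gammaV.
set N := gamma (p + q.+2); have hN : is_subgroup N := is_subgroup_gamma _ _.
apply: (@gen_subset [set w | N [~ w, x]]) hy; last first.
  move=> _ [u hu [v _ <-]] /=.
  have /(canRL (mulgK _)) := hall_witt u v^-1 x.
  rewrite invgK mul1g => /(canRL (mulgK _)) /(canRL (conjgK _)) ->.
  apply: gamma_conj; apply: (is_subgroupM hN); apply: gammaV; apply: gamma_conj.
    by rewrite addnS; apply: gamma_commS; apply: IHq => //; exact: gammaV.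
  rewrite addnS -addSn; apply: IHq; last exact: hu.
  rewrite -invgR; apply: gammaV; apply: gamma_commS. exact: gammaV.
split=> [|u v /= hu hv]; first by rewrite /= comm1g; exact: hN.1.
rewrite commMgJ commVgJ; apply: (is_subgroupM hN) => //;
  apply: gamma_conj => //.
exact: gammaV.
Qed.

(** In the next lemmas [S] is a subgroup containing [gamma n.+1]; as [gamma n]
   is central modulo [gamma n.+1], membership in [S] of an element of [gamma n]
   only depends on its class in the abelian group [gamma n / gamma n.+1], where
   the commutator is bilinear and satisfies the Jacobi identity. *)
Lemma mem_conj S n x y : is_subgroup S -> gamma n.+1 `<=` S ->
  gamma n x -> S x -> S (x ^ y).
Proof.
move=> hS hg hx Sx; rewrite -[x ^ y](mulVKg x) -commgEl.
by apply: (is_subgroupM hS) => //; apply: hg; exact: gamma_commS.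
Qed.

(** Linearity of the commutator in its first argument, modulo [S]. *)
Lemma mem_comm_subgroup S p q y : is_subgroup S ->
  gamma (p + q).+1 `<=` S -> gamma q y ->
  is_subgroup [set x | gamma p x /\ S [~ x, y]].
Proof.
move=> hS hg hy; split=> [|u v [hu Su] [hv Sv]].
  by rewrite /= comm1g; split; [exact: (is_subgroup_gamma _ _).1|exact: hS.1].
have Sv' : S [~ v^-1, y].
  rewrite commVgJ; apply: (mem_conj _ hS hg); last exact: (is_subgroupV hS).
  by apply: gammaV; exact: gamma_comm.
split; first by apply: gammaM => //; exact: gammaV.
rewrite commMgJ; apply: (is_subgroupM hS) Sv' => //.
by apply: (mem_conj _ hS hg) => //; exact: gamma_comm.
Qed.

Lemma mem_comm_gen S p q y (A : set G) : is_subgroup S ->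
  gamma (p + q).+1 `<=` S -> gamma q y -> A `<=` gamma p ->
  (forall a, A a -> S [~ a, y]) ->
  forall x, gen (A `|` gamma p.+1) x -> S [~ x, y].
Proof.
move=> hS hg hy hA SA x hx.
suff [] : gamma p x /\ S [~ x, y] by [].
apply: (gen_subset (mem_comm_subgroup hS hg hy)) hx => a [Aa|ha].
  by split; [exact: hA|exact: SA].
split; first exact: gamma_decr.
by apply: hg; rewrite -addSn; exact: gamma_comm.
Qed.

Lemma mem_comm_conj S p q x y g : is_subgroup S ->
  gamma (p + q).+1 `<=` S -> gamma p x -> gamma q y ->
  S [~ x, y] -> S [~ x ^ g, y].
Proof.
move=> hS hg hx hy Sxy; rewrite -[x ^ g](mulVKg x) -commgEl.
have hT := mem_comm_subgroup hS hg hy.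
have [] // := is_subgroupM hT (conj hx Sxy) (conj _ _ : _ [~ x, g]).
  by apply: gamma_decr; exact: gamma_commS.
by apply: hg; rewrite -addSn; apply: gamma_comm => //; exact: gamma_commS.
Qed.

Lemma mem_commV S p q x y : is_subgroup S ->
  gamma (p + q).+1 `<=` S -> gamma p x -> gamma q y ->
  S [~ x, y] -> S [~ x^-1, y].
Proof.
move=> hS hg hx hy Sxy; rewrite commVgJ; apply: (mem_conj _ hS hg).
  by apply: gammaV; exact: gamma_comm.
exact: (is_subgroupV hS).
Qed.

(** The Jacobi identity, from the Hall-Witt identity at [x], [y^-1], [z]: modulo
   [S] the inverses only change signs and the conjugations act trivially. *)
Lemma mem_jacobi S p q r x y z : is_subgroup S ->
  gamma (p + q + r).+1 `<=` S -> gamma p x -> gamma q y -> gamma r z ->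
  S [~ [~ y, z], x] -> S [~ [~ z, x], y] -> S [~ [~ x, y], z].
Proof.
move=> hS hg hx hy hz S1 S2.
have E1 : (q + r + p = p + q + r)%N by rewrite addnC addnA.
have E2 : (r + p + q = p + q + r)%N by rewrite -addnA addnC.
have /(canRL (mulgK _)) := hall_witt x y^-1 z.
rewrite invgK mul1g => /(canRL (mulgK _)) /(canRL (conjgK _)) ->.
have hyz := gamma_comm hy hz; have hzx := gamma_comm hz hx.
apply: (mem_conj _ hS hg); last (apply: (is_subgroupM hS) => //).
- apply: gammaM; apply: gammaV; apply: gamma_conj.
    rewrite -E2; apply: gamma_comm; last exact: gammaV.
    by apply: gamma_comm => //; exact: gammaV.
  rewrite -E1; apply: gamma_comm => //.
  by apply: gamma_comm; exact: gammaV.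
- apply: (is_subgroupV hS) => //; apply: (mem_conj _ hS hg).
    rewrite -E2; apply: gamma_comm; last exact: gammaV.
    by apply: gamma_comm => //; exact: gammaV.
  rewrite commgVJ commgVJ; rewrite -E2 in hg.
  apply: (mem_conj _ hS hg).
    apply: gammaV; apply: gamma_comm => //; apply: gamma_conj; exact: gammaV.
  apply: (is_subgroupV hS) => //.
  apply: (mem_comm_conj _ hS hg _ hy); first exact: gammaV.
  exact: (mem_commV hS hg _ hy).
- apply: (is_subgroupV hS) => //; apply: (mem_conj _ hS hg).
    rewrite -E1; apply: gamma_comm => //.
    by apply: gamma_comm; exact: gammaV.
  by rewrite commVVJ; rewrite -E1 in hg; exact: (mem_comm_conj _ hS hg _ hx).
Qed.

End CommutatorCalculus.

(** * Lyndon words and their standard bracketings *)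

Section LyndonTrees.
Variables (disp : Order.disp_t) (A : orderType disp).

Local Notation word := (seqlexi A).
Implicit Types u v w x y : word.

Local Notation catw u v := ((u ++ v)%SEQ : word).
Local Notation dropw k u := (drop k u : word).

Lemma ltxi_cat2l u v w : (catw u v < catw u w)%O = (v < w)%O.
Proof. by elim: u => //= a u IHu; rewrite ltxi_cons lexx. Qed.

(** A strict lexicographic inequality either comes from a proper prefix or is
   decided at a letter, and then persists whatever is appended. *)
Lemma ltxi_catP u v : (u < v)%O ->
  (exists2 w : word, w != [::] & v = catw u w) \/
  (forall x y, catw u x < catw v y)%O.
Proof.
elim: u v => [|a u IHu] [|b v] //; first by left; exists (b :: v).
rewrite ltxi_cons => /andP[]; case: (comparableP a b) => //= [ab _ _|-> _ uv].
  by right=> x y; rewrite ltxi_cons (ltW ab) leNgt ab.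
have [[w w0 ->]|H] := IHu _ uv; first by left; exists w.
by right=> x y; rewrite ltxi_cons lexx H.
Qed.

Lemma ltxi_cat u v x y : (size v <= size u)%N -> (u < v)%O ->
  (catw u x < catw v y)%O.
Proof.
move=> + /ltxi_catP[[w w0 vE]|]; last by [].
by rewrite vE size_cat -{2}(addn0 (size u)) leq_add2l leqn0 size_eq0 (negPf w0).
Qed.

Definition lyndon w : Prop := w != [::] /\
  forall k, (0 < k < size w)%N -> (w < dropw k w)%O.

(** If [u] is a prefix of [v], the remaining suffix of [v] exceeds [v]. *)
Lemma lyndon_cat_lt u v : lyndon u -> lyndon v -> (u < v)%O ->
  (catw u v < v)%O.
Proof.
move=> [u0 _] [_ hv] /[dup] uv /ltxi_catP[[w w0 vE]|/(_ v [::])]; last first.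
  by rewrite cats0.
have dE : drop (size u) v = w by rewrite vE drop_size_cat.
rewrite [X in (_ < X)%O]vE ltxi_cat2l -[X in (_ < X)%O]dE; apply: hv.
rewrite vE size_cat lt0n size_eq0 u0 -{1}[size u]addn0 ltn_add2l.
by rewrite lt0n size_eq0 w0.
Qed.

(** A suffix starting inside [u] is decided against [u] at a letter of [u],
   being shorter than it. *)
Lemma lyndon_cat u v : lyndon u -> lyndon v -> (u < v)%O -> lyndon (catw u v).
Proof.
move=> hu hv uv; have uvv := lyndon_cat_lt hu hv uv; split.
  by case: hu => + _; case: (u).
move=> k /andP[k0]; rewrite size_cat drop_cat => kuv.
case: ltnP => ku; last first.
  have [->|k'0] := posnP (k - size u); first by rewrite drop0.
  by apply: lt_trans uvv (hv.2 _ _); rewrite k'0 ltn_subLR.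
by apply: ltxi_cat; [rewrite size_drop leq_subr|apply: hu.2; rewrite k0].
Qed.

Inductive tree := Leaf of A | Node of tree & tree.

Fixpoint foliage (t : tree) : word :=
  match t with Leaf a => [:: a] | Node s t => catw (foliage s) (foliage t) end.

(** These trees are the standard bracketings of the Lyndon words: the condition
   on [s] amounts to [foliage t] being the longest proper Lyndon suffix of the
   foliage of [Node s t]. *)
Fixpoint standard (t : tree) : bool :=
  if t is Node s t then
    [&& standard s, standard t, (foliage s < foliage t)%O &
        if s is Node _ s2 then (foliage t <= foliage s2)%O else true]
  else true.

Lemma foliage_neq0 t : foliage t != [::].
Proof. by elim: t => //= s hs t ht; case: (foliage s) hs. Qed.

Lemma size_foliage_gt0 t : (0 < size (foliage t))%N.
Proof. by rewrite lt0n size_eq0 foliage_neq0. Qed.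

Lemma standard_lyndon t : standard t -> lyndon (foliage t).
Proof.
elim: t => [a _|s hs t ht /= /and4P[/hs Ls /ht Lt st _]]; last first.
  exact: lyndon_cat.
by split=> // -[|[|k]].
Qed.

(** By induction, the proper suffixes of [foliage s] are at least [foliage s2],
   hence at least [foliage t]; this recovers [foliage t] from the foliage of
   [Node s t]. *)
Lemma standard_min_suffix s t k : standard (Node s t) ->
  (0 < k < size (foliage (Node s t)))%N ->
  (foliage t <= dropw k (foliage (Node s t)))%O.
Proof.
move=> hst; pose P (u : tree) := if u is Node _ t' then forall k,
  (0 < k < size (foliage u))%N -> (foliage t' <= dropw k (foliage u))%O
  else True.
suff /(_ k) : P (Node s t) by [].
elim: (Node s t) hst => {s t k} [//|[a|s1 s2] IHs t _] /=.
  case/and3P=> /standard_lyndon Lt _ _ [//|[|k]]; first by rewrite /= drop0.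
  by move=> hk; rewrite /=; apply/ltW/Lt.2.
case/and4P=> hs /standard_lyndon Lt st hts k /andP[k0].
rewrite size_cat drop_cat => ks; case: ltnP => hk; last first.
  have [->|k'0] := posnP (k - size (foliage s1 ++ foliage s2))%N.
    by rewrite drop0.
  by apply: ltW; apply: Lt.2; rewrite k'0 ltn_subLR.
have := IHs hs k; rewrite /= k0 hk => /(_ isT) h2.
apply: le_trans (le_trans hts h2) _.
rewrite -[X in (X <= _)%O]cats0; elim: (drop _ _) => //= c w IHw.
by rewrite lexi_cons lexx.
Qed.

Lemma foliage_inj t t' : standard t -> standard t' ->
  foliage t = foliage t' -> t = t'.
Proof.
elim: t t' => [a|s IHs t IHt] [b|s' t'] //=.
- by move=> _ _ [->].
- by move=> _ _ /(congr1 size); rewrite size_cat; have := size_foliage_gt0 s';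
    have := size_foliage_gt0 t'; case: size => //= n; case: size => //= m _ _;
    rewrite addnS.
- by move=> _ _ /(congr1 size); rewrite size_cat; have := size_foliage_gt0 s;
    have := size_foliage_gt0 t; case: size => //= n; case: size => //= m _ _;
    rewrite addnS.
move=> S S' E; case/and4P: (S) => hs ht _ _; case/and4P: (S') => hs' ht' _ _.
have le_suffix s1 t1 s2 t2 : standard (Node s1 t1) ->
    catw (foliage s1) (foliage t1) = catw (foliage s2) (foliage t2) ->
    (foliage t1 <= foliage t2)%O.
  move=> h1 e; have := standard_min_suffix h1 (k := size (foliage s2)).
  rewrite /= e  drop_size_cat //; apply.
  rewrite size_foliage_gt0 size_cat -{1}[size (foliage s2)]addn0 ltn_add2l.
  exact: size_foliage_gt0.
have Et : foliage t = foliage t'.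
  apply: le_anti; rewrite (le_suffix _ _ _ _ S E).
  exact: (le_suffix _ _ _ _ S' (esym E)).
congr Node; last exact: IHt.
apply: IHs => //; have /eqP := E; rewrite Et eqseq_cat.
  by move=> /andP[/eqP].
by have /(congr1 size)/eqP := E; rewrite !size_cat Et eqn_add2r => /eqP.
Qed.

End LyndonTrees.

(** * Basic commutators span the lower central quotients *)

Section BasicCommutators.
Variables (disp : Order.disp_t) (A : finOrderType disp).
Variables (G : groupType) (X : A -> G).

Local Notation word := (seqlexi A).
Local Notation tree := (tree A).
Implicit Types (u v w : word) (s t : tree) (P Q : pred word).

Fixpoint commtree t : G :=
  match t with Leaf a => X a | Node s t => [~ commtree s, commtree t] end.

Definition weight t : nat := size (foliage t).

Lemma gamma_commtree t : gamma (weight t) (commtree t).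
Proof.
by elim: t => //= s hs t ht; rewrite /weight /= size_cat; exact: gamma_comm.
Qed.

Definition basic_commutators n P : set G :=
  [set commtree t | t in
    [set t | [/\ standard t, weight t = n & P (foliage t)]]].

Definition basic_span n P : set G :=
  gen (basic_commutators n P `|` gamma n.+1).

Lemma basic_span_subgroup n P : is_subgroup (basic_span n P).
Proof. exact: is_subgroup_gen. Qed.

Lemma gamma_basic_span n P : gamma n.+1 `<=` basic_span n P.
Proof. by move=> x hx; apply: gen_incl; right. Qed.

Lemma basic_commutators_gamma n P : basic_commutators n P `<=` gamma n.
Proof. by move=> _ [t [_ <- _] <-]; exact: gamma_commtree. Qed.

Lemma basic_span_gamma n P : basic_span n P `<=` gamma n.
Proof.
apply: gen_subset => [|x [/basic_commutators_gamma //|/gamma_decr //]].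
exact: is_subgroup_gamma.
Qed.

Lemma basic_spanS n P Q : (forall w, size w = n -> P w -> Q w) ->
  basic_span n P `<=` basic_span n Q.
Proof.
move=> PQ; apply: gen_subset; first exact: is_subgroup_gen.
move=> x [[t [ht wt Pt] <-]|hx]; apply: gen_incl; last by right.
by left; exists t => //; split=> //; exact: PQ wt Pt.
Qed.

Lemma mem_basic_span n P t : standard t -> weight t = n -> P (foliage t) ->
  basic_span n P (commtree t).
Proof. by move=> *; apply: gen_incl; left; exists t. Qed.

(** The lexicographic order is well founded on the words of bounded length. *)
Definition word_rank n v : nat :=
  #|[pred s : n.-bseq A | (((s : seq A) : word) < v)%O]|.

Lemma word_rank_lt n u v : (size u <= n)%N -> (u < v)%O ->
  (word_rank n u < word_rank n v)%N.
Proof.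
move=> un uv; apply: proper_card; apply/properP; split.
  by apply/fintype.subsetP => s; rewrite !inE => su; exact: lt_trans uv.
by exists (Bseq un); rewrite inE /= ?ltxx.
Qed.

(** The commutator of two basic commutators is a combination of basic ones. If
   [Node s t] with [s = Node a b] is not standard, the Jacobi identity
   rewrites [[a, b], t] in terms of [[b, t], a] and [[t, a], b]. The inner
   commutators have smaller weight, so they expand into basic commutators
   whose foliage is less than that of [t], and then the outer ones concern
   pairs of trees with foliages below that of [t]: the induction is on the
   weight [n] first, and then on the bound [v]. The strict bound in the
   conclusion is what feeds it. *)
Lemma basic_span_comm n v s t : standard s -> standard t ->
  (weight s + weight t)%N = n -> (foliage s <= v)%O -> (foliage t <= v)%O ->
  basic_span n (< v)%O [~ commtree s, commtree t].
Proof.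
elim/ltn_ind: n v s t => n IHn v.
have [m] := ubnP (word_rank n v); elim: m v => // m IHm v.
rewrite ltnS => vm.
suff main s t : standard s -> standard t -> (weight s + weight t)%N = n ->
    (foliage s < foliage t)%O -> (foliage t <= v)%O ->
    basic_span n (< v)%O [~ commtree s, commtree t].
  move=> s t hs ht wst sv tv.
  have [st|ts|/(foliage_inj hs ht) ->] := ltgtP (foliage s) (foliage t).
  - exact: (main s t).
  - rewrite -invgR; apply: (is_subgroupV (basic_span_subgroup _ _)).
    by apply: (main t s) => //; rewrite addnC.
  - by rewrite commgg; exact: (is_subgroup_gen _).1.
move=> hs ht wst st tv.
have Lst : (foliage (Node s t) < foliage t)%O.
  by apply: lyndon_cat_lt => //; exact: standard_lyndon.
have [hst|] := boolP (standard (Node s t)).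
  apply: (@mem_basic_span _ _ (Node s t)) => //.
    by rewrite -wst /weight /= size_cat.
  exact: lt_le_trans tv.
rewrite /= hs ht st /=; case: s hs wst st Lst => [//|a b] hab wst st Lst.
rewrite -ltNge => bt; have /and4P[ha hb ab _] := hab.
have at_ : (foliage a < foliage t)%O.
  apply: le_lt_trans st => /=; elim: (foliage a) => //= c w IHw.
  by rewrite lexi_cons lexx.
move: wst; rewrite {1}/weight /= size_cat -!/(weight _) => wst.
have S_comm k x e : basic_span k (< foliage t)%O x -> standard e ->
    (foliage e < foliage t)%O -> (k + weight e)%N = n ->
    basic_span n (< v)%O [~ x, commtree e].
  move=> hx he et ke.
  apply: (@mem_comm_gen _ _ k (weight e)) hx.
  - exact: basic_span_subgroup.
  - by rewrite ke; exact: gamma_basic_span.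
  - exact: gamma_commtree.
  - exact: basic_commutators_gamma.
  move=> _ [w [hw wk wt] <-].
  pose v' := Order.max (foliage w) (foliage e).
  have v't : (v' < v)%O by rewrite gt_max !(lt_le_trans _ tv).
  have v'n : (size v' <= n)%N.
    rewrite /v' -ke -wk; case: (leP (foliage w)) => _; rewrite /weight.
      exact: leq_addl.
    exact: leq_addr.
  apply: basic_spanS (IHm v' _ w e hw he _ _ _).
  - by move=> z _ /lt_trans; apply.
  - exact: leq_trans (word_rank_lt v'n v't) vm.
  - by rewrite wk.
  - by rewrite le_max lexx.
  - by rewrite le_max lexx orbT.
apply: (@mem_jacobi _ (basic_span n (< v)%O) (weight a) (weight b) (weight t)
  (commtree a) (commtree b) (commtree t)).
- exact: basic_span_subgroup.
- by rewrite wst; exact: gamma_basic_span.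
- exact: gamma_commtree.
- exact: gamma_commtree.
- exact: gamma_commtree.
- apply: (S_comm (weight b + weight t)%N) => //; last first.
    by rewrite -wst addnC addnA.
  apply: IHn => //; last exact: ltW.
  by rewrite -wst -addnA -[X in (X < _)%N]add0n ltn_add2r size_foliage_gt0.
- apply: (S_comm (weight t + weight a)%N) => //; last first.
    by rewrite -wst -addnA addnC.
  apply: IHn => //; last exact: ltW.
  rewrite -wst addnC addnAC -[X in (X < _)%N]addn0 ltn_add2l.
  exact: size_foliage_gt0.
Qed.

Hypothesis genX : gen (range X) = setT.

Lemma gamma_basic n : (0 < n)%N -> gamma n `<=` basic_span n predT.
Proof.
case: n => // n _; elim: n => [|n IHn].
  move=> x _; have : gen (range X) x by rewrite genX.
  apply: gen_subset => [|_ [a _ <-]]; first exact: basic_span_subgroup.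
  exact: (@mem_basic_span _ _ (Leaf a)).
set S := basic_span n.+2 predT.
have hS : is_subgroup S by exact: is_subgroup_gen.
have hg : gamma n.+3 `<=` S := @gamma_basic_span n.+2 predT.
apply: gen_subset => // _ [x /IHn hx [y _ <-]].
apply: (@mem_comm_gen _ S n.+1 1 y _ hS _ _ (@basic_commutators_gamma _ _)) hx
  => //.
  by rewrite addn1.
move=> _ [t [ht wt _] <-].
rewrite -invgR; apply: (is_subgroupV hS).
have hy : gen (range X `|` gamma 2) y.
  have : gen (range X) y by rewrite genX.
  apply: gen_subset => [|z Xz]; first exact: is_subgroup_gen.
  by apply: gen_incl; left.
apply: (@mem_comm_gen _ S 1 n.+1 _ _ hS _ _ _ _) hy => //.
  by rewrite -wt; exact: gamma_commtree.
move=> _ [a _ <-].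
pose v := Order.max (foliage (Leaf a)) (foliage t).
apply: (@basic_spanS n.+2 (< v)%O predT) => //.
apply: (@basic_span_comm _ _ (Leaf a)) => //; first by rewrite wt.
  by rewrite le_max lexx.
by rewrite le_max lexx orbT.
Qed.

End BasicCommutators.

(** * The Magnus expansion *)

(** Each unit is packed with its inverse, so that the group of units needs no
   inversion function on the ring. *)
Section RingUnits.
Variable R : pzRingType.

Record ring_unit := RingUnit {
  unit_val : R;
  unit_inv : R;
  unit_valK : (unit_val * unit_inv = 1)%R;
  unit_invK : (unit_inv * unit_val = 1)%R
}.

HB.instance Definition _ := gen_eqMixin ring_unit.
HB.instance Definition _ := gen_choiceMixin ring_unit.

Lemma ring_unitP (u v : ring_unit) : unit_val u = unit_val v -> u = v.
Proof.
case: u v => [u u' uK u'K] [v v' vK v'K] /= uv; subst v.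
have u'v' : u' = v' by rewrite -[u']mulr1 -vK mulrA u'K mul1r.
by subst v'; congr RingUnit; exact: Prop_irrelevance.
Qed.

Lemma ring_unit_mulK (u v : ring_unit) :
  (unit_val u * unit_val v * (unit_inv v * unit_inv u) = 1)%R.
Proof. by rewrite mulrA -(mulrA (unit_val u)) unit_valK mulr1 unit_valK. Qed.

Lemma ring_unit_mulVK (u v : ring_unit) :
  (unit_inv v * unit_inv u * (unit_val u * unit_val v) = 1)%R.
Proof. by rewrite mulrA -(mulrA (unit_inv v)) unit_invK mulr1 unit_invK. Qed.

Definition ring_unit_one := RingUnit (mulr1 1%R : 1 * 1 = 1 :> R)%R (mulr1 1%R).
Definition ring_unit_mul u v :=
  RingUnit (ring_unit_mulK u v) (ring_unit_mulVK u v).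
Definition ring_unit_inv u := RingUnit (unit_invK u) (unit_valK u).

Lemma ring_unit_mulA : associative ring_unit_mul.
Proof. by move=> u v w; apply: ring_unitP; exact: mulrA. Qed.
Lemma ring_unit_mul1 : left_id ring_unit_one ring_unit_mul.
Proof. by move=> u; apply: ring_unitP; exact: mul1r. Qed.
Lemma ring_unit_mulr1 : right_id ring_unit_one ring_unit_mul.
Proof. by move=> u; apply: ring_unitP; exact: mulr1. Qed.
Lemma ring_unit_mulV : left_inverse ring_unit_one ring_unit_inv ring_unit_mul.
Proof. by move=> u; apply: ring_unitP; exact: unit_invK. Qed.
Lemma ring_unit_mulrV : right_inverse ring_unit_one ring_unit_inv ring_unit_mul.
Proof. by move=> u; apply: ring_unitP; exact: unit_valK. Qed.

HB.instance Definition _ := isGroup.Build ring_unit ring_unit_mulA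
  ring_unit_mul1 ring_unit_mulr1 ring_unit_mulV ring_unit_mulrV.

End RingUnits.

(** The ring of formal power series in noncommuting variables indexed by [A],
   encoded by their coefficients. *)
Definition series (A : Type) : Type := seq A -> int.

Section Series.
Variable A : eqType.
Implicit Types (f g h : series A) (w : seq A).

HB.instance Definition _ := GRing.Zmodule.on (series A).

Local Open Scope ring_scope.

Definition shift_series f (a : A) : series A := fun w => f (a :: w).

(** The coefficient at [w] is the sum of [f u * g v] over the factorizations
   [w = u ++ v]; the recursion peels off the first letter of [u]. *)
Fixpoint series_mul f g w : int :=
  if w is a :: w' then f [::] * g w + series_mul (shift_series f a) g w'
  else f [::] * g [::].

Definition series_one : series A := fun w => (w == [::])%:R.

Lemma series_addE f g w : (f + g) w = f w + g w. Proof. by []. Qed.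
Lemma series_oppE f w : (- f) w = - f w. Proof. by []. Qed.

Lemma series_mul0r g : series_mul 0 g = 0.
Proof.
apply/funext; elim=> [|a w IHw] /=; first by rewrite mul0r.
by rewrite [X in _ + X](IHw : _ = 0) addr0 mul0r.
Qed.

Lemma series_mulZl (c : int) f g w :
  series_mul (fun w => c * f w) g w = c * series_mul f g w.
Proof.
elim: w f => [|a w IHw] f /=; first by rewrite mulrA.
by rewrite mulrDr mulrA [X in _ + X](IHw (shift_series f a)).
Qed.

Lemma series_mulDl : left_distributive series_mul +%R.
Proof.
move=> f g h; apply/funext => w; rewrite series_addE.
elim: w f g => [|a w IHw] f g /=; first by rewrite series_addE mulrDl.
rewrite series_addE mulrDl -!addrA; congr (_ + _).
by rewrite addrCA; congr (_ + _); rewrite -IHw.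
Qed.

Lemma series_mulDr : right_distributive series_mul +%R.
Proof.
move=> f g h; apply/funext => w; rewrite series_addE.
elim: w f => [|a w IHw] f /=; first by rewrite series_addE mulrDr.
rewrite series_addE mulrDr -!addrA IHw; congr (_ + _).
by rewrite addrCA.
Qed.

Lemma series_mul1 : left_id series_one series_mul.
Proof.
move=> g; apply/funext => -[|a w] /=; first by rewrite mul1r.
have -> : shift_series series_one a = 0 by apply/funext.
by rewrite series_mul0r mul1r addr0.
Qed.

Lemma series_mulr1 : right_id series_one series_mul.
Proof.
move=> f; apply/funext => w; elim: w f => [|a w IHw] f /=.
  by rewrite mulr1.
by rewrite IHw mulr0 add0r.
Qed.

Lemma series_mulA : associative series_mul.
Proof.
move=> f g h; apply/funext => w; elim: w f => [|a w IHw] f /=.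
  by rewrite mulrA.
have -> : shift_series (series_mul f g) a =
    (fun w => f [::] * shift_series g a w) + series_mul (shift_series f a) g.
  by [].
rewrite series_mulDl series_addE series_mulZl IHw mulrDr -addrA.
by congr (_ + _); case: w {IHw} => [|b w] /=; rewrite mulrA.
Qed.

HB.instance Definition _ := GRing.Zmodule_isPzRing.Build (series A)
  series_mulA series_mul1 series_mulr1 series_mulDl series_mulDr.

Lemma series_mul_nil f g : (f * g) [::] = f [::] * g [::].
Proof. by []. Qed.

Lemma series_mul_cons f g a w :
  (f * g) (a :: w) = f [::] * g (a :: w) + (shift_series f a * g) w.
Proof. by []. Qed.

Definition order_ge n f : Prop := forall w, (size w < n)%N -> f w = 0.

Lemma order_geD n f g : order_ge n f -> order_ge n g -> order_ge n (f + g).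
Proof. by move=> hf hg w hw; rewrite series_addE hf ?hg ?addr0. Qed.

Lemma order_geN n f : order_ge n f -> order_ge n (- f).
Proof. by move=> hf w hw; rewrite series_oppE hf ?oppr0. Qed.

(** The lowest terms of a product come from the lowest terms of the factors. *)
Lemma order_ge_mul_coef p q f g w : order_ge p f -> order_ge q g ->
  (size w <= p + q)%N ->
  (f * g) w = if size w == (p + q)%N then f (take p w) * g (drop p w) else 0.
Proof.
elim: p f w => [|p IHp] f w hf hg hw.
  rewrite take0 drop0 add0n; rewrite add0n in hw.
  case: w hw => [|a w] hw /=.
    rewrite series_mul_nil; case: eqP => // q0; rewrite hg ?mulr0 // lt0n.
    exact/eqP/nesym.
  rewrite series_mul_cons.
  have -> : (shift_series f a * g) w = 0.
    elim: w (shift_series f a) hw => [|b w IHw] f' hw.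
      by rewrite series_mul_nil hg ?mulr0.
    rewrite series_mul_cons hg ?mulr0 ?add0r; last exact: hw.
    by apply: IHw; exact: ltnW.
  rewrite addr0; case: eqP => // nq; rewrite hg ?mulr0 //.
  by rewrite ltn_neqAle hw andbT; apply/eqP.
case: w hw => [|a w] hw.
  by rewrite series_mul_nil hf // mul0r.
rewrite series_mul_cons hf // mul0r add0r IHp //.
by move=> u hu; exact: hf.
Qed.

Lemma order_geM p q f g :
  order_ge p f -> order_ge q g -> order_ge (p + q) (f * g).
Proof.
by move=> hf hg w hw; rewrite (order_ge_mul_coef hf hg) 1?ltnW // ltn_eqF.
Qed.

Lemma order_ge_mull q f g : order_ge q g -> order_ge q (f * g).
Proof. by move=> hg; rewrite -[q]add0n; apply: order_geM. Qed.

Definition letter a : series A := fun w => (w == [:: a])%:R.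

(** The inverse of [1 + letter a], a geometric series. *)
Definition letter_geom a : series A :=
  fun w => if all (pred1 a) w then (-1) ^+ size w else 0.

Lemma shift_letter a b :
  shift_series (1 + letter a) b = if b == a then 1 else 0.
Proof.
apply/funext => w; rewrite /shift_series series_addE /letter.
have -> : (1 : series A) (b :: w) = 0 by [].
rewrite add0r eqseq_cons; by case: (b == a).
Qed.

Lemma letter_geomK a : (1 + letter a) * letter_geom a = 1.
Proof.
apply/funext => -[|b w]; first by rewrite series_mul_nil.
rewrite series_mul_cons shift_letter.
have -> : (1 + letter a) [::] = 1 by [].
rewrite mul1r [RHS](_ : _ = 0) // {1}/letter_geom /=.
case: (b == a) => /=; last by rewrite mul0r.
rewrite mul1r /letter_geom; case: ifP => _; last by rewrite addr0.
by rewrite exprS mulN1r addNr.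
Qed.

Lemma letter_geomVK a : letter_geom a * (1 + letter a) = 1.
Proof.
apply/funext; elim=> [|b w IHw]; first by rewrite series_mul_nil.
rewrite series_mul_cons.
have -> : letter_geom a [::] = 1 by [].
rewrite mul1r [RHS](_ : _ = 0) //.
rewrite -[(1 + letter a) (b :: w)]/(shift_series (1 + letter a) b w).
rewrite shift_letter.
have -> : shift_series (letter_geom a) b =
    if b == a then - letter_geom a else 0.
  apply/funext => u; rewrite /shift_series /letter_geom /=.
  case: (b == a) => //=; rewrite series_oppE; case: ifP => _.
    by rewrite exprS mulN1r.
  by rewrite oppr0.
case: (b == a); last by rewrite mul0r addr0.
by rewrite mulNr series_oppE IHw subrr.
Qed.

Definition letter_unit a : ring_unit (series A) :=
  RingUnit (letter_geomK a) (letter_geomVK a).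

End Series.

(** * The lower central quotients of a free group are torsion-free *)

Section MagnusCoefficients.
Variables (disp : Order.disp_t) (A : finOrderType disp).
Variables (F : groupType) (X : A -> F) (mu : F -> ring_unit (series A)).
Hypothesis muM : {morph mu : x y / x * y}.
Hypothesis muX : forall a, mu (X a) = letter_unit a.
Hypothesis genX : gen (range X) = setT.

Local Notation word := (seqlexi A).
Implicit Types (x y : F) (u v w : word) (t : tree A) (P : pred word).

(* Locked, since rewriting with the ring axioms would unfold it to a
   difference. *)
Definition magnus x : series A := locked (unit_val (mu x) - 1)%R.

Lemma magnusE x : magnus x = (unit_val (mu x) - 1)%R.
Proof. by rewrite /magnus -lock. Qed.

Lemma unit_val_mu x : unit_val (mu x) = (1 + magnus x)%R.
Proof. by rewrite magnusE addrC subrK. Qed.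

Lemma magnus1 : magnus 1 = 0%R.
Proof.
have mu1 : mu 1 = 1 by apply: (@mulgI _ (mu 1)); rewrite -muM !mulg1.
by rewrite magnusE mu1; exact: subrr.
Qed.

Lemma magnusM x y :
  magnus (x * y) = (magnus x + magnus y + magnus x * magnus y)%R.
Proof.
rewrite magnusE muM -[unit_val _]/(unit_val (mu x) * unit_val (mu y))%R.
rewrite !unit_val_mu mulrDl mul1r mulrDr mulr1; apply/eqP; rewrite subr_eq.
apply/eqP.
by rewrite [RHS]addrC -!addrA; congr (_ + _)%R; rewrite addrCA.
Qed.

Lemma magnus_div x y :
  magnus (x / y) = ((magnus x - magnus y) * (1 + magnus y^-1))%R.
Proof.
rewrite -unit_val_mu !magnusE opprB addrA subrK mulrBl.
have uM a b : unit_val (mu (a * b)) = (unit_val (mu a) * unit_val (mu b))%R.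
  by rewrite muM.
rewrite -!uM mulgV; congr (_ - _)%R.
by rewrite unit_val_mu magnus1 addr0.
Qed.

(** Expands [x * y = (y * x) * [~ x, y]]; the lowest terms for a commutator are
   thus the ring commutator of those for [x] and [y]. *)
Lemma magnus_comm x y : magnus [~ x, y] =
  ((1 + magnus (y * x)^-1) *
   (magnus x * magnus y - magnus y * magnus x))%R.
Proof.
have uM a b : unit_val (mu (a * b)) = (unit_val (mu a) * unit_val (mu b))%R.
  by rewrite muM.
have e : (magnus x * magnus y - magnus y * magnus x = 
    unit_val (mu (x * y)) - unit_val (mu (y * x)))%R.
  rewrite !unit_val_mu !magnusM (addrC (magnus y) (magnus x)) !addrA.
  by rewrite opprD addrACA subrr add0r.
rewrite e -unit_val_mu mulrBr -!uM mulVg.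
have -> : (y * x)^-1 * (x * y) = [~ x, y] by group_norm.
by rewrite [LHS]magnusE (unit_val_mu 1) magnus1 addr0.
Qed.

Lemma order_ge_subgroup n : is_subgroup [set x | order_ge n (magnus x)].
Proof.
split=> [|x y hx hy] /=; first by rewrite magnus1.
rewrite magnus_div -[n]addn0; apply: order_geM => //.
by apply: order_geD => //; exact: order_geN.
Qed.

(** A unit could also have the constant term [-1]: that it is [1] comes from the
   generators. *)
Lemma magnus_nil x : magnus x [::] = 0%R.
Proof.
suff : order_ge 1 (magnus x) by apply.
have : gen (range X) x by rewrite genX.
apply: (gen_subset (order_ge_subgroup 1)) => _ [a _ <-] [|//] _.
by rewrite magnusE muX.
Qed.

Lemma magnus_gamma n x : gamma n x -> order_ge n (magnus x).
Proof.
have h1 y : order_ge 1 (magnus y) by case=> [|//] _; exact: magnus_nil.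
elim: n x => [|[|n] IHn] x //.
apply: (gen_subset (order_ge_subgroup n.+2)) => _ [y hy [z _ <-]] /=.
rewrite magnus_comm; apply: order_ge_mull; apply: order_geD.
  by rewrite -addn1; apply: order_geM => //; exact: IHn.
by apply: order_geN; rewrite -add1n; apply: order_geM => //; exact: IHn.
Qed.

Lemma magnus_comm_coef p q x y w : gamma p x -> gamma q y ->
  size w = (p + q)%N -> magnus [~ x, y] w =
  (magnus x (take p w) * magnus y (drop p w) -
   magnus y (take q w) * magnus x (drop q w))%R.
Proof.
move=> /magnus_gamma hx /magnus_gamma hy wE; rewrite magnus_comm.
have hxy := order_geM hx hy; have := order_geM hy hx; rewrite addnC => hyx.
rewrite (@order_ge_mul_coef _ 0 (p + q)) ?wE ?eqxx ?take0 ?drop0 //; last first.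
  by apply: order_geD => //; exact: order_geN.
rewrite !series_addE magnus_nil addr0 [X in (X * _)%R](_ : _ = 1%R) // mul1r.
rewrite series_oppE (order_ge_mul_coef hx hy) ?wE // eqxx; congr (_ - _)%R.
by rewrite (order_ge_mul_coef hy hx) ?wE 1?addnC // eqxx.
Qed.

(** On [gamma n] the coefficients of degree [n] are additive, the products of
   two nonconstant terms having degree at least [2 * n]. *)
Section LeadingCoefficients.
Variable n : nat.
Hypothesis n_gt0 : (0 < n)%N.

Lemma magnusM_coef x y w : gamma n x -> gamma n y -> size w = n ->
  magnus (x * y) w = (magnus x w + magnus y w)%R.
Proof.
move=> /magnus_gamma hx /magnus_gamma hy wE.
rewrite magnusM !series_addE (order_geM hx hy) ?addr0 // wE.
by rewrite -[X in (X < _)%N]addn0 ltn_add2l.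
Qed.

Lemma magnusV_coef x w : gamma n x -> size w = n ->
  magnus x^-1 w = (- magnus x w)%R.
Proof.
move=> hx wE; apply/eqP; rewrite -addr_eq0 -magnusM_coef //; last exact: gammaV.
by rewrite mulVg magnus1.
Qed.

Lemma magnusX_coef x w k : gamma n x -> size w = n ->
  magnus (x ^+ k) w = (magnus x w *+ k)%R.
Proof.
move=> hx wE.
suff [] : gamma n (x ^+ k) /\ magnus (x ^+ k) w = (magnus x w *+ k)%R by [].
elim: k => [|k [hk IHk]].
  by rewrite magnus1; split=> //; exact: (is_subgroup_gamma _ _).1.
by rewrite expgS magnusM_coef // IHk mulrS; split=> //; exact: gammaM.
Qed.

Lemma gamma_expgz x (e : int) : gamma n x -> gamma n (expgz x e).
Proof.
move=> hx; have hX k : gamma n (x ^+ k).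
  elim: k => [|k IHk]; first exact: (is_subgroup_gamma _ _).1.
  by rewrite expgS; exact: gammaM.
by case: e => k; [exact: hX|exact: gammaV].
Qed.

Lemma magnus_expgz_coef x (e : int) w : gamma n x -> size w = n ->
  magnus (expgz x e) w = (e * magnus x w)%R.
Proof.
move=> hx wE; case: e => k /=; first by rewrite magnusX_coef // -mulr_natl natz.
rewrite magnusV_coef //; last exact: (@gamma_expgz _ k.+1).
by rewrite magnusX_coef // NegzE -mulr_natl natz mulNr.
Qed.

End LeadingCoefficients.

Lemma lexi_cat_eqsize u v (u' v' : word) : size u = size u' ->
  ((u ++ v : word) <= (u' ++ v' : word))%O ->
  (u <= u')%O /\ (u = u' -> (v <= v')%O).
Proof.
move=> uu' le; split=> [|e].
  rewrite leNgt; apply/negP => u'u; move: le; apply/negP.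
  by rewrite -ltNge; apply: ltxi_cat; rewrite ?uu'.
by move: le; rewrite e !leNgt ltxi_cat2l.
Qed.

(** The lowest terms for a basic commutator are its Lyndon word plus a
   combination of larger words: in the ring commutator of the terms for [s]
   and [t], the product in reverse order only has words from [foliage t ++
   foliage s] on, which exceeds [foliage s ++ foliage t]. *)
Lemma magnus_commtree t w : standard t -> size w = weight t ->
  (w <= foliage t)%O -> magnus (commtree X t) w = (w == foliage t)%:R%R.
Proof.
elim: t w => [a|s IHs t IHt] w.
  move=> _ wE _; rewrite /= magnusE muX /=.
  by rewrite /letter [(1 + _)%R]addrC addrK.
move=> st; have Lst : (foliage (Node s t) < foliage t)%O.
  by case/and4P: st => *; apply: lyndon_cat_lt => //; exact: standard_lyndon.
case/and4P: st => hs ht st _.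
rewrite /weight /= size_cat -!/(weight _) => wE wle.
rewrite (magnus_comm_coef (gamma_commtree X s) (gamma_commtree X t) wE).
have -> : magnus (commtree X t) (take (weight t) w) = 0%R.
  have st' : size (take (weight t) w) = weight t.
    by rewrite size_takel // wE leq_addl.
  have := wle; rewrite -{1}(cat_take_drop (weight t) w) => wle'.
  have lt_t : ((take (weight t) w : word) < foliage t)%O.
    rewrite ltNge; apply/negP => tle.
    have : (foliage t <= (take (weight t) w ++ drop (weight t) w : word))%O.
      apply: le_trans tle _; elim: (take _ _) => //= c z IHz.
      by rewrite lexi_cons lexx.
    by move=> /(lt_le_trans Lst); rewrite ltNge wle'.
  by rewrite IHt ?(ltW lt_t) // lt_eqF.
rewrite mul0r subr0.
have ss : size (take (weight s) w) = size (foliage s).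
  by rewrite size_takel // wE leq_addr.
have := wle; rewrite -{1}(cat_take_drop (weight s) w).
move=> /(lexi_cat_eqsize ss)[ws wt].
rewrite IHs // -[in RHS](cat_take_drop (weight s) w) eqseq_cat //.
case: eqP => [es|_] /=; last by rewrite mul0r.
by rewrite mul1r IHt //; [rewrite size_drop wE addKn|exact: wt].
Qed.

End MagnusCoefficients.

Section TorsionFree.
Variables (disp : Order.disp_t) (A : finOrderType disp).
Variables (F : groupType) (X : A -> F) (mu : F -> ring_unit (series A)).
Hypothesis muM : {morph mu : x y / x * y}.
Hypothesis muX : forall a, mu (X a) = letter_unit a.
Hypothesis genX : gen (range X) = setT.

Local Notation word := (seqlexi A).
Local Notation magnus := (magnus mu).
Implicit Types (x y : F) (u v w : word) (t : tree A) (P : pred word).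

Lemma magnus_basic_span n v P x : (0 < n)%N -> size v = n ->
  (forall w, P w -> (v < w)%O) -> basic_span X n P x -> magnus x v = 0%R.
Proof.
move=> n0 vn vP hx.
suff [] : gamma n x /\ magnus x v = 0%R by [].
pose T := [set y | gamma n y /\ magnus y v = 0%R].
apply: (@gen_subset _ T _ _ _ x hx) => [|y [[t [ht wt Pt] <-]|hy]].
- split=> [|y z [hy y0] [hz z0]]; rewrite /T /=.
    by rewrite (magnus1 muM); split=> //;
    exact: (is_subgroup_gamma _ _).1.
  have hz' := gammaV hz; split; first exact: gammaM.
  rewrite (magnusM_coef muM muX genX n0) ?(magnusV_coef muM muX genX n0) //.
  by rewrite y0 z0 subrr.
- have tv := vP _ Pt; split; first by rewrite -wt; exact: gamma_commtree.
  by rewrite (magnus_commtree muM muX genX) ?wt ?(ltW tv) // lt_eqF.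
- split; first exact: gamma_decr.
  by apply: (magnus_gamma muM muX genX hy); rewrite vn.
Qed.

Lemma basic_span_cons n t (L : seq word) x : standard t -> weight t = n ->
  basic_span X n (mem (foliage t :: L)) x ->
  exists e : int, basic_span X n (mem L) (expgz (commtree X t) e * x).
Proof.
move=> ht wt hx; set c := commtree X t; set S := basic_span X n (mem L).
have hS : is_subgroup S by exact: basic_span_subgroup.
have hg : gamma n.+1 `<=` S by exact: gamma_basic_span.
have hc : gamma n c by rewrite -wt; exact: gamma_commtree.
suff [] : gamma n x /\ exists e : int, S (expgz c e * x) by [].
pose T := [set y | gamma n y /\ exists e : int, S (expgz c e * y)].
apply: (@gen_subset _ T _ _ _ x hx) => [|y [[t' [ht' wt']]|hy]].
- split=> [|y z [hy [e he]] [hz [f hf]]]; rewrite /T /=.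
    split; first exact: (is_subgroup_gamma _ _).1.
    by exists 0%R; rewrite mulg1; exact: hS.1.
  split; first by apply: gammaM => //; exact: gammaV.
  have := hS.2 _ _ he hf; set s := _ / _ => Ss; exists (e - f)%R.
  have -> : expgz c (e - f)%R * (y / z) = s ^ expgz c f.
    have -> : expgz c (e - f)%R = (expgz c f)^-1 * expgz c e.
      rewrite addrC expgzD; congr (_ * _); apply/esym/mulg1_eq.
      by rewrite -expgzD addrN.
    by rewrite /s conjgE invgM !mulgA mulgVK.
  apply: (mem_conj _ hS hg) => //; apply: gammaM.
    by apply: gammaM => //; exact: gamma_expgz.
  by apply: gammaV; apply: gammaM => //; exact: gamma_expgz.
- rewrite /= inE => /orP[/eqP/(foliage_inj ht' ht) -> <-|Lt <-].
    split=> //; exists (-1)%R; rewrite /= mulVg; exact: hS.1.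
  split; first by rewrite -wt'; exact: gamma_commtree.
  by exists 0%R; rewrite mul1g; exact: mem_basic_span.
- by split; [exact: gamma_decr|exists 0%R; rewrite mul1g; exact: hg].
Qed.

(** The lowest terms for the basic commutators of weight [n] are triangular with
   respect to the Lyndon words, hence linearly independent. *)
Lemma basic_span_independent n (L : seq word) x : (0 < n)%N ->
  sorted <%O L -> basic_span X n (mem L) x ->
  (forall w, size w = n -> magnus x w = 0%R) -> gamma n.+1 x.
Proof.
move=> n0; elim: L x => [|v L IHL] x /=.
  move=> _ hx _; apply: (@gen_subset _ (gamma n.+1) _ _ _ x hx).
    exact: is_subgroup_gamma.
  by move=> y [[t [_ _ Lt] _]|].
move=> sL hx mx; have sL' := path_sorted sL.
have vL w : w \in L -> (v < w)%O.
  by move: sL; rewrite lt_path_sortedE => /andP[/allP + _]; apply.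
(* A word that is not Lyndon of length [n] contributes nothing to the span. *)
have [[t [ht wt tv]]|noT] :=
  pselect (exists t, [/\ standard t, weight t = n & foliage t = v]); last first.
  apply: IHL => //; pose S := basic_span X n (mem L).
  apply: (@gen_subset _ S _ _ _ x hx) => [|y [[t [ht wt]]|hy]].
  - exact: basic_span_subgroup.
  - rewrite /= inE => /orP[/eqP tv|Lt <-]; last exact: mem_basic_span.
    by case: noT; exists t.
  - exact: gamma_basic_span.
rewrite -tv in hx; have [e he] := basic_span_cons ht wt hx.
have hc : gamma n (commtree X t) by rewrite -wt; exact: gamma_commtree.
have vn : size v = n by rewrite -tv.
have := magnus_basic_span n0 vn vL he.
rewrite (magnusM_coef muM muX genX n0) //; first last.
- exact: basic_span_gamma hx.
- exact: gamma_expgz.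
rewrite mx // addr0 (magnus_expgz_coef muM muX genX n0) // -tv.
rewrite (magnus_commtree muM muX genX) // eqxx mulr1 => e0.
by move: he; rewrite e0 mul1g => he; exact: IHL.
Qed.

Lemma gamma_magnus_eq0 n x : (0 < n)%N -> gamma n x ->
  (forall w, size w = n -> magnus x w = 0%R) -> gamma n.+1 x.
Proof.
move=> n0 hx.
pose L : seq word :=
  sort <=%O (map (fun s : n.-tuple A => tval s : word) (enum {: n.-tuple A})).
apply: (@basic_span_independent n L) => //.
  by rewrite sort_lt_sorted map_inj_uniq ?enum_uniq //; exact: val_inj.
apply: basic_spanS (gamma_basic genX n0 hx) => w wn _.
rewrite /= mem_sort; apply/mapP; exists (Tuple (introT eqP wn)) => //.
exact: mem_enum.
Qed.

(** The coefficients of degree [n] for [x ^+ k] are [k] times those for [x]. *)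
Lemma gamma_root n x k : (0 < k)%N -> gamma n (x ^+ k) -> gamma n x.
Proof.
move=> k0; elim: n => [//|[//|n] IHn] hxk.
have hx := IHn (gamma_decr hxk).
apply: gamma_magnus_eq0 => // w wn; apply/eqP.
have := magnus_gamma muM muX genX hxk; move/(_ w); rewrite wn => /(_ (leqnn _)).
rewrite (magnusX_coef muM muX genX _ _ hx) // => /eqP.
by rewrite -mulr_natr mulf_eq0 pnatr_eq0 eqn0Ngt k0 orbF.
Qed.

End TorsionFree.

(** * Automorphisms acting unipotently on the lower central quotients *)

Section ActionChains.
Variables (F : groupType) (Act : set (aut F)).
Implicit Types (x y z : F) (alpha : aut F) (M N : set F) (K L : nat -> set F).

(** A witness that [Act] acts unipotently on the section between [M] and [N], as
   [x^-1 * alpha x] is the value of [alpha - 1] at [x]. *)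
Definition unipotent_chain (M N : set F) (K : nat -> set F) (m : nat) : Prop :=
  [/\ M `<=` K 0 /\ K m `<=` N,
      forall j, is_subgroup (K j) /\ N `<=` K j,
      forall j, K j.+1 `<=` K j &
      forall alpha j x, Act alpha -> K j x -> K j.+1 (x^-1 * alpha x)].

Lemma unipotent_chain_le M N K m i j : unipotent_chain M N K m ->
  (i <= j)%N -> K j `<=` K i.
Proof.
case=> _ _ hK _ /subnK <-; elim: (j - i)%N => [//|k IHk].
by rewrite addSn; apply: subset_trans IHk; exact: hK.
Qed.

(** The tensor product filtration, carried over by the commutator map. *)
Definition comm_chain n K L (j : nat) : set F :=
  gen ([set z | exists x y a b,
          [/\ K a x, L b y, (j <= a + b)%N & z = [~ x, y]]] `|` gamma n.+2).

(** As the commutator map [gamma n x F -> gamma n.+1] is bilinear modulo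
   [gamma n.+2] and has generating image, unipotence on [gamma n / gamma n.+1]
   and on the abelianization passes to [gamma n.+1 / gamma n.+2], just as it
   does to the tensor product of two representations. *)
Lemma unipotent_chain_comm n K L m l : (0 < n)%N ->
  unipotent_chain (gamma n) (gamma n.+1) K m -> K 0 `<=` gamma n ->
  unipotent_chain setT (gamma 2) L l ->
  unipotent_chain (gamma n.+1) (gamma n.+2) (comm_chain n K L) (m + l) /\
  comm_chain n K L 0 `<=` gamma n.+1.
Proof.
move=> n0 cK K0 cL.
have Kn a x : K a x -> gamma n x.
  by move=> Kx; apply: K0; exact: unipotent_chain_le cK (leq0n a) _ Kx.
have sub j : comm_chain n K L j `<=` gamma n.+1.
  apply: gen_subset; first exact: is_subgroup_gamma.
  move=> z [[x [y [a [b [Kx _ _ ->]]]]]|]; last exact: gamma_decr.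
  by apply: gamma_commS; exact: Kn Kx.
have gens j a b x y : K a x -> L b y -> (j <= a + b)%N ->
    comm_chain n K L j [~ x, y].
  by move=> Kx Ly jab; apply: gen_incl; left; exists x, y, a, b.
split=> //; split=> [|j|j|alpha j x hal hx].
- split.
    case: n n0 {sub gens} Kn cK K0 => // n _ _ cK K0.
    apply: gen_subset => [|_ [x hx [y _ <-]]]; first exact: is_subgroup_gen.
    apply: gen_incl; left; exists x, y, 0%N, 0%N; split=> //.
      by case: cK => -[H _] _ _ _; exact: H.
    by case: cL => -[H _] _ _ _; exact: H.
  apply: gen_subset; first exact: is_subgroup_gamma.
  move=> z [[x [y [a [b [Kx Ly mlab ->]]]]]|//].
  have [ma|am] := leqP m a.
    apply: gamma_commS; case: (cK) => -[_ H] _ _ _; apply: H.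
    exact: unipotent_chain_le cK ma _ Kx.
  rewrite -addn2; apply: gamma_comm; first exact: Kn Kx.
  case: (cL) => -[_ H] _ _ _; apply: H.
  have lb : (l <= b)%N.
    by rewrite -(leq_add2l m) (leq_trans mlab) // leq_add2r ltnW.
  exact: unipotent_chain_le cL lb _ Ly.
- by split; [exact: is_subgroup_gen|move=> x hx; apply: gen_incl; right].
- apply: gen_subset; first exact: is_subgroup_gen.
  move=> z [[x [y [a [b [Kx Ly jab ->]]]]]|hx]; last by apply: gen_incl; right.
  by apply: gens Kx Ly _; exact: ltnW.
set S := comm_chain n K L j.+1; have hS : is_subgroup S := is_subgroup_gen _.
have hg : gamma n.+2 `<=` S by move=> z hz; apply: gen_incl; right.
have gal k z : gamma k z -> gamma k (alpha z) := lcs_morph (@autM _ alpha).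
suff [] : gamma n.+1 x /\ S (x^-1 * alpha x) by [].
move: x hx; apply: gen_subset => [|z [[x [y [a [b [Kx Ly jab ->]]]]]|hz]].
- split=> [|z1 z2 [h1 S1] [h2 S2]].
    rewrite /= autg1 mulg1 invg1.
    by split; [exact: (is_subgroup_gamma _ _).1|exact: hS.1].
  have h2' := gammaV h2; split; first exact: gammaM.
  have -> : (z1 / z2)^-1 * alpha (z1 / z2) =
      ((z1^-1 * alpha z1) / (z2^-1 * alpha z2)) ^ z2^-1.
    by rewrite autM autV; group_norm.
  apply: (mem_conj _ hS hg); last exact: hS.2.
  apply: gammaM; last apply: gammaV.
    by apply: gammaM; [exact: gammaV|exact: gal].
  by apply: gammaM; [exact: gammaV|exact: gal].
- have hc : gamma n.+1 [~ x, y] by apply: gamma_commS; exact: Kn Kx.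
  split=> //; set x' := x^-1 * alpha x; set y' := y^-1 * alpha y.
  have Kx' : K a.+1 x' by case: cK => _ _ _; apply.
  have Ly' : L b.+1 y' by case: cL => _ _ _; apply.
  have Lyy' : L b (alpha y).
    case: cL => _ hL dL _; rewrite -(mulVKg y (alpha y)).
    by apply: is_subgroupM (hL b).1 Ly _; exact: dL.
  (* All three factors lie in [S]: [alpha x = x * x'] and [alpha y = y * y']. *)
  have -> : [~ x, y]^-1 * alpha [~ x, y] =
      ([~ x, y'] ^ x') ^ [~ x, y] * [~ [~ x, y], y' * x'] * [~ x', alpha y].
    rewrite [alpha [~ x, y]](_ : _ = [~ alpha x, alpha y]); last first.
      by rewrite /commg /conjg !autM !autV.
    rewrite -{1}(mulVKg x (alpha x)) -/x' -(mulVKg y (alpha y)) -/y'.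
    by group_norm.
  apply: (is_subgroupM hS); last by apply: gens Kx' Lyy' _; rewrite addSn.
  apply: (is_subgroupM hS); last by apply: hg; exact: gamma_commS.
  have Sxy' : S [~ x, y'] by apply: gens Kx Ly' _; rewrite addnS.
  have hxy' : gamma n.+1 [~ x, y'] by apply: gamma_commS; exact: Kn Kx.
  apply: (mem_conj _ hS hg); first exact: gamma_conj.
  exact: (mem_conj _ hS hg).
- split; first exact: gamma_decr.
  by apply: hg; apply: gammaM; [exact: gammaV|exact: gal].
Qed.

Lemma unipotent_chain_gamma L l n : (0 < n)%N ->
  unipotent_chain setT (gamma 2) L l ->
  exists K m, unipotent_chain (gamma n) (gamma n.+1) K m.
Proof.
move=> + cL; case: n => // n _.
suff [K [m []]] : exists K m, unipotent_chain (gamma n.+1) (gamma n.+2) K m /\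
    K 0 `<=` gamma n.+1 by exists K, m.
elim: n => [|n [K [m [cK K0]]]]; first by exists L, l.
by exists (comm_chain n.+1 K L), (m + l)%N; exact: unipotent_chain_comm.
Qed.

End ActionChains.

Section UnipotentHomology.
Variables (F : groupType) (phi : aut F).
Implicit Types (g h : aut F) (v : H1 F).

Local Notation u := (fun w : H1 F => (H1_map phi w - w)%R).

Lemma H1_mapM g h v : H1_map (g * h) v = H1_map g (H1_map h v).
Proof. by elim/toH1W: v => x; rewrite !H1_mapE. Qed.

Lemma H1_map1 v : H1_map 1 v = v.
Proof. by elim/toH1W: v => x; rewrite H1_mapE. Qed.

Lemma H1_map0 g : H1_map g 0%R = 0%R.
Proof. by apply: (@addrI _ (H1_map g 0%R)); rewrite -H1_mapD !addr0. Qed.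

Lemma H1_mapN g v : H1_map g (- v)%R = (- H1_map g v)%R.
Proof. by apply/eqP; rewrite -addr_eq0 -H1_mapD addNr H1_map0. Qed.

Lemma iter_u0 k : iter k u 0%R = 0%R.
Proof. by elim: k => //= k ->; rewrite H1_map0 subr0. Qed.

Lemma iter_uD k v w : iter k u (v + w)%R = (iter k u v + iter k u w)%R.
Proof. by elim: k => //= k ->; rewrite H1_mapD opprD addrACA. Qed.

Lemma iter_uN k v : iter k u (- v)%R = (- iter k u v)%R.
Proof. by apply/eqP; rewrite -addr_eq0 -iter_uD addNr iter_u0. Qed.

(** These automorphisms form a group that contains [phi] and the inner ones,
   hence all those by which [F ><| Z] acts on [F]. *)
Definition kernel_unipotent : set (aut F) :=
  [set g | (forall v, H1_map g (H1_map phi v) = H1_map phi (H1_map g v)) /\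
    forall k v, iter k.+1 u v = 0%R -> iter k u (H1_map g v - v)%R = 0%R].

Lemma iter_u_comm g k v :
  (forall v, H1_map g (H1_map phi v) = H1_map phi (H1_map g v)) ->
  iter k u (H1_map g v) = H1_map g (iter k u v).
Proof. by move=> hg; elim: k => //= k ->; rewrite H1_mapD H1_mapN hg. Qed.

Lemma kernel_unipotent_subgroup : is_subgroup kernel_unipotent.
Proof.
split=> [|g h [gphi hg] [hphi hh]].
  by split=> [v|k v _]; rewrite !H1_map1 // subrr iter_u0.
have hV v : H1_map h^-1 (H1_map phi v) = H1_map phi (H1_map h^-1 v).
  rewrite -[v in LHS](H1_map1 v) -(mulgV h) H1_mapM -hphi -H1_mapM mulVg.
  exact: H1_map1.
split=> [v|k v hv]; first by rewrite !H1_mapM hV gphi.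
have hVv : iter k u (H1_map (h^-1)%g v - v)%R = 0%R.
  have -> : (H1_map (h^-1)%g v - v)%R = H1_map h^-1 (- (H1_map h v - v))%R.
    by rewrite opprB H1_mapD H1_mapN -H1_mapM mulVg H1_map1.
  by rewrite iter_u_comm // iter_uN hh // oppr0 H1_map0.
rewrite H1_mapM -(subrK (H1_map g v) (H1_map g _)) -addrA iter_uD hg // addr0.
by rewrite -H1_mapN -H1_mapD iter_u_comm // hVv H1_map0.
Qed.

Lemma kernel_unipotent_phi : kernel_unipotent phi.
Proof. by split=> // k v; rewrite iterSr. Qed.

Lemma kernel_unipotent_inner x : kernel_unipotent (inner x).
Proof.
have E v : H1_map (inner x) v = v.
  elim/toH1W: v => y; rewrite H1_mapE /= conjgE !toH1M addrCA.
  by rewrite -[X in (_ + X)%R]toH1M mulVg toH1_1 addr0.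
by split=> [v|k v _]; rewrite !E // subrr iter_u0.
Qed.

(** The kernels of the powers of [u], pulled back to [F], form the chain. *)
Lemma unipotent_chain_H1 m : (forall v, iter m u v = 0%R) ->
  exists K l, unipotent_chain kernel_unipotent setT (gamma 2) K l.
Proof.
move=> hm; exists (fun j => [set x | iter (m - j) u (toH1 x) = 0%R]), m.
have H1_2 x : gamma 2 x -> toH1 x = 0%R.
  move=> hx; rewrite -toH1_1; apply/H1_eqP; rewrite mulg1; exact: gammaV.
split=> [|j|j x|g j x [_ hg]] /=.
- split=> x /= => [_|]; first by rewrite subn0; exact: hm.
  by rewrite subnn /= -toH1_1 => /esym /H1_eqP; rewrite invg1 mul1g.
- split; last by move=> x /H1_2 x0 /=; rewrite x0 iter_u0.
  split=> [|x y /= hx hy]; first by rewrite /= toH1_1 iter_u0.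
  have -> : toH1 (x / y) = (toH1 x - toH1 y)%R.
    by apply/eqP; rewrite eq_sym subr_eq -toH1M mulgVK.
  by rewrite iter_uD iter_uN hx hy subr0.
- have [mj|jm] := leqP m j; last first.
    by rewrite -(subnSK jm) /= => ->; rewrite H1_map0 subr0.
  have -> : (m - j = m - j.+1)%N; last by [].
  by have := leqW mj; move: mj; rewrite -!subn_eq0 => /eqP -> /eqP ->.
have -> : toH1 (x^-1 * g x) = (H1_map g (toH1 x) - toH1 x)%R.
  by rewrite H1_mapE; apply/eqP; rewrite eq_sym subr_eq addrC -toH1M mulVKg.
have [mj|jm] := leqP m j; last by rewrite -(subnSK jm); exact: hg.
have -> : (m - j = 0)%N by apply/eqP; rewrite subn_eq0.
have -> : (m - j.+1 = 0)%N by apply/eqP; rewrite subn_eq0 ltnW.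
by move=> /= ->; rewrite H1_map0 subr0.
Qed.

End UnipotentHomology.

(** * Free groups *)

Section SubgroupAsGroup.
Variables (G : groupType) (H : set G) (hH : is_subgroup H).

Record subgroup_of := SubgroupOf { sub_val : G; sub_valP : H sub_val }.

(** The proof that [H] is a subgroup is a parameter of the type, from which the
   group structure is then inferred. *)
Definition subgroup_type of is_subgroup H := subgroup_of.
Local Notation sT := (subgroup_type hH).

HB.instance Definition _ := gen_eqMixin sT.
HB.instance Definition _ := gen_choiceMixin sT.

Lemma sub_val_inj (x y : subgroup_of) : sub_val x = sub_val y -> x = y.
Proof.
case: x y => [x xP] [y yP] /= xy; subst y.
by congr SubgroupOf; exact: Prop_irrelevance.
Qed.

Definition sub_one : sT := SubgroupOf hH.1.
Definition sub_mul (x y : sT) : sT :=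
  SubgroupOf (is_subgroupM hH (sub_valP x) (sub_valP y)).
Definition sub_inv (x : sT) : sT := SubgroupOf (is_subgroupV hH (sub_valP x)).

Lemma sub_mulA : associative sub_mul.
Proof. by move=> x y z; apply: sub_val_inj; exact: mulgA. Qed.
Lemma sub_mul1 : left_id sub_one sub_mul.
Proof. by move=> x; apply: sub_val_inj; exact: mul1g. Qed.
Lemma sub_mulr1 : right_id sub_one sub_mul.
Proof. by move=> x; apply: sub_val_inj; exact: mulg1. Qed.
Lemma sub_mulV : left_inverse sub_one sub_inv sub_mul.
Proof. by move=> x; apply: sub_val_inj; exact: mulVg. Qed.
Lemma sub_mulrV : right_inverse sub_one sub_inv sub_mul.
Proof. by move=> x; apply: sub_val_inj; exact: mulgV. Qed.

HB.instance Definition _ := isGroup.Build sT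
  sub_mulA sub_mul1 sub_mulr1 sub_mulV sub_mulrV.

End SubgroupAsGroup.

(** The universal property retracts [F] onto the subgroup generated by the
   basis, and uniqueness forces this retraction to be the identity. *)
Lemma free_basis_gen (F : groupType) (r : nat) (X : 'I_r -> F) :
  free_basis X -> gen (range X) = setT.
Proof.
move=> FX; pose hE := @is_subgroup_gen F (range X).
have XE i : gen (range X) (X i) by apply: gen_incl; exists i.
have [f [[fM fX] _]] := FX (subgroup_type hE) (fun i => SubgroupOf (XE i)).
have [g [_ gU]] := FX F X.
apply/seteqP; split=> // x _.
have gid : g = id by apply: gU.
have gf : g = fun y => sub_val (f y).
  by apply: gU; split=> [y z|i]; rewrite ?fM ?fX.
rewrite -[x]/(id x) -gid gf; exact: sub_valP.
Qed.

Lemma free_gamma_root (F : groupType) (r : nat) (X : 'I_r -> F) n (x : F) k :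
  free_basis X -> (0 < k)%N -> gamma n (x ^+ k) -> gamma n x.
Proof.
move=> FX; have genX := free_basis_gen FX.
have [mu [[muM muX] _]] := FX (ring_unit (series 'I_r)) (@letter_unit 'I_r).
exact: (gamma_root muM muX genX).
Qed.

(** * The quotients of the mapping torus *)

Section MappingTorus.
Variables (F : groupType) (phi : aut F) (n : nat).

(* The group structure on pairs depends on [phi], which the type [sdprodZ F]
   does not show: it is named explicitly. *)
Local Notation G := (Defs_sdprodZ__canonical__monoid_Group phi).
Local Notation Q := (quot (sdprodZ_gammaN phi n)).
Local Notation inl := (@sdprodZ_inl F : F -> G).

Definition quot_image (K : set F) : set Q :=
  [set \pi_Q (inl x) | x in K].

Lemma quot_image_subgroup K : is_subgroup K -> is_subgroup (quot_image K).
Proof.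
move=> hK; split; first by exists 1 => //; exact: hK.1.
move=> _ _ [x Kx <-] [y Ky <-]; exists (x / y); first exact: hK.2.
have -> : inl (x / y) = (inl x / inl y : G) by congr (_, _).
by rewrite quot_piM; congr (_ * _); rewrite -quot_invE.
Qed.

Lemma quot_piR (a b : G) : \pi_Q [~ a, b] = [~ \pi_Q a, \pi_Q b].
Proof. by rewrite /commg /conjg !quot_piM -!quot_invE. Qed.

Lemma lcs1_quot : lcs 1 `<=` quot_image setT.
Proof.
apply: gen_subset => [|_ [c _ [d _ <-]]]; first exact: quot_image_subgroup.
elim/quot_elim: c => -[x i]; elim/quot_elim: d => -[y j].
rewrite -quot_piR.
exists ([~ ((x, i) : G), (y, j)].1) => //; congr (\pi_Q _).
rewrite /sdprodZ_inl.
set c := [~ _, _]; rewrite [RHS]surjective_pairing; congr (_, _).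
by rewrite /c /= (addrC i) addKr addNr.
Qed.

Lemma conj_inl (x : F) (v : G) :
  (inl x ^ v : G) = inl ((expgz phi (- v.2)%R * inner v.1) x).
Proof.
case: v => a m /=; rewrite [LHS]/conjg; congr (_, _).
  by rewrite /= -autM conjgE.
by rewrite /= add0r addNr.
Qed.

(** An element of [F ><| Z] commutes with [x] up to [x^-1 * alpha x], where
   [alpha] is its action on [F]. *)
Lemma lcs_unipotent_chain (Act : set (aut F)) (M N : set F) K m k :
  (forall a l, Act (expgz phi l * inner a)) ->
  unipotent_chain Act M N K m -> lcs k `<=` quot_image M ->
  lcs (k + m) `<=` quot_image N.
Proof.
move=> hAct [[M0 mN] hK _ hA] hk.
suff H j : lcs (k + j) `<=` quot_image (K j).
  by move=> c /H [x Kx <-]; exists x => //; exact: mN.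
elim: j => [|j IHj].
  by rewrite addn0 => c /hk [x Mx <-]; exists x => //; exact: M0.
rewrite addnS; apply: gen_subset; first exact/quot_image_subgroup/(hK _).1.
move=> _ [c /IHj [x Kx <-] [d _ <-]]; elim/quot_elim: d => v.
rewrite -quot_piR commgEl conj_inl.
exists (x^-1 * (expgz phi (- v.2)%R * inner v.1 : aut F) x).
  by apply: hA => //; exact: hAct.
by congr (\pi_Q _); rewrite /sdprodZ_inl; congr (_, _).
Qed.

End MappingTorus.

Theorem theorem3p12 (R : realType) (F : groupType) (r : nat) (X : 'I_r -> F)
    (FX : free_basis X) (phi : aut F)
    (phi_growth : polynomially_growing X R phi) (phi_unip : unipotent phi)
    (n : nat) (n_ge1 : (1 <= n)%N) :
  torsion_free (quot (sdprodZ_gammaN phi n)) /\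
  nilpotent (quot (sdprodZ_gammaN phi n)).
Proof.
pose G := Defs_sdprodZ__canonical__monoid_Group phi.
split.
  elim/quot_elim=> -[x l] k k0.
  have piX (v : G) :
      \pi_(quot (sdprodZ_gammaN phi n)) (v ^+ k) =
      (\pi_(quot (sdprodZ_gammaN phi n)) v) ^+ k.
    by elim: {k0} k => [//|k IHk]; rewrite !expgS quot_piM IHk.
  rewrite -piX => /esym /quot_eqP; rewrite invg1 mul1g => -[y hy e].
  have snd_expg j : (((x, l) : G) ^+ j).2 = (l *+ j)%R.
    by elim: j => [//|j IHj]; rewrite expgS mulrS -IHj.
  have l0 : l = 0%R.
    have /(congr1 snd) := e; rewrite snd_expg /= => /esym/eqP.
    by rewrite -mulr_natr mulf_eq0 pnatr_eq0 eqn0Ngt k0 orbF => /eqP.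
  rewrite l0 in e *.
  have inl_expg j : ((x, 0%R) : G) ^+ j = (x ^+ j, 0%R).
    by elim: j => [//|j IHj]; rewrite !expgS IHj; congr (_, _).
  have yE : y = x ^+ k by move: e; rewrite inl_expg => -[].
  apply/esym/quot_eqP; rewrite invg1 mul1g; exists x => //.
  by rewrite yE in hy; exact: free_gamma_root FX k0 hy.
have [m hm] := phi_unip; rewrite out_H1E in hm.
have [L [l cL]] := unipotent_chain_H1 hm.
have hAct a i : kernel_unipotent phi (expgz phi i * inner a).
  have hB := kernel_unipotent_subgroup phi.
  apply: (is_subgroupM hB); last exact: kernel_unipotent_inner.
  have hX j : kernel_unipotent phi (phi ^+ j).
    elim: j => [|j IHj]; first exact: hB.1.
    rewrite expgS; apply: (is_subgroupM hB) => //.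
    exact: kernel_unipotent_phi.
  by case: i => j; [exact: hX|apply: (is_subgroupV hB); exact: hX].
suff /(_ n n_ge1) [k hk] : forall i, (0 < i)%N ->
    exists k, lcs k `<=` @quot_image F phi n (gamma i).
  exists k.+1; apply/seteqP; split=> [c /hk [x hx <-]|_ ->]; last first.
    exact: (is_subgroup_gamma _ _).1.
  apply/esym/quot_eqP; rewrite invg1 mul1g; by exists x.
case=> // i _; elim: i => [|i IHi]; first by exists 1%N; exact: lcs1_quot.
have [k hk] := IHi.
have [K [d cK]] := unipotent_chain_gamma (ltn0Sn i) cL.
by exists (k + d)%N; exact: lcs_unipotent_chain hAct cK hk.
Qed.
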